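(* Let $n\ge 2$, let $K=K(t,x,u,u_1,\dots,u_n)$ be smooth with $\partial K/\partial u_n$ nowhere zero, and consider $u_t=K$. Let $\mathcal S=\sum_i s_i(t,x,u,u_1,\dots)D_x^i$ be a nonzero skew-adjoint differential operator. Then the form $\Sigma=dx\wedge\theta^0_E\wedge\sum_i s_i\theta^i_E$ on $E=\mathbb R\times J^\infty(\mathbb R,\mathbb R)$ is symplectic and $Y=\mathrm{pr}(K\partial_u)$ is a Hamiltonian vector field for $\Sigma$ if and only if $$\omega=dx\wedge\theta^0\wedge\epsilon-dt\wedge\boldsymbol\beta(\epsilon),\qquad \epsilon=\sum_i s_i\theta^i,$$ satisfies $d_H\omega=0$ on $\mathcal R^\infty$, where $\boldsymbol\beta(\epsilon)=\sum_{i=1}^n\sum_{a=1}^i(-X)^{a-1}\big(\frac{\partial K}{\partial u_i}\,\epsilon\big)\wedge\theta^{i-a}$.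
   Context: Write $u_0=u$, $u_1=u_x$, $u_i=\partial_x^i u$; smooth functions depend on finitely many coordinates. $\mathcal R^\infty$ is the infinitely prolonged equation manifold of $u_t=K$, with coordinates $(t,x,u,u_1,u_2,\dots)$. On it $X=\partial_x+\sum_i u_{i+1}\partial_{u_i}$, $T=\partial_t+\sum_i X^i(K)\partial_{u_i}$, $\theta^i=du_i-X^i(K)\,dt-u_{i+1}\,dx$. $X$ and $T$ act on forms by Lie derivative (so they annihilate $dt,dx$ and $X(\theta^i)=\theta^{i+1}$). On forms generated by $dt,dx,\theta^i$, $d_H\omega=dx\wedge X(\omega)+dt\wedge T(\omega)$. $E=\mathbb R\times J^\infty(\mathbb R,\mathbb R)$ also has coordinates $(t,x,u,u_1,u_2,\dots)$ and functions on $E$ and $\mathcal R^\infty$ are identified; $D_x=\partial_x+\sum_i u_{i+1}\partial_{u_i}$, $\theta^i_E=du_i-u_{i+1}dx$. $\Omega^{r,s}_{t_{sb}}(E)$ ($r=0,1$) is the space of forms that are finite sums of a function on $E$ times $dx$ ($r$ times) wedged with $s$ of the $\theta^i_E$. $D_x$ acts on these forms as a derivation with $D_x(dx)=0$, $D_x(\theta^i_E)=\theta^{i+1}_E$; $d^E_V$ is the anti-derivation with $d^E_Vf=\sum_i(\partial f/\partial u_i)\theta^i_E$, $d_V^E(dx)=0$, $d^E_V\theta^i_E=0$. For $\Sigma\in\Omega^{1,s}_{t_{sb}}(E)$, $s\ge1$, $I_E(\Sigma)=\frac1s\theta^0_E\wedge\sum_i(-D_x)^i(\partial_{u_i}\lrcorner\,\Sigma)$,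 and $\delta^E_V=I_E\circ d^E_V$. Skew-adjoint means $\sum_i(-D_x)^i(s_if)=-\sum_is_iD_x^i(f)$ for all $f$. For $\mathcal S$ skew-adjoint, $\Sigma=dx\wedge\theta^0_E\wedge\sum_i s_i\theta^i_E$ is symplectic if $\Sigma\ne0$ and $\delta^E_V\Sigma=0$. $Y=\mathrm{pr}(K\partial_u)=\sum_iD_x^i(K)\partial_{u_i}$ is a Hamiltonian vector field for $\Sigma$ if $I_E\circ\pi^{1,2}\circ\mathcal L_T\Sigma=0$ with $T=\partial_t+Y$, $\mathcal L_T$ the Lie derivative, and $\pi^{1,2}$ the projection that keeps only the $dx\wedge\theta^i_E\wedge\theta^j_E$ terms in the coframe $dt,dx,\theta^i_E$. *)

(* Defs.v *)
From HB Require Import structures.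
From mathcomp Require Import all_boot all_order all_algebra.
From mathcomp Require Import all_classical all_reals all_analysis.
Import Order.TTheory GRing.Theory Num.Theory.
Import numFieldNormedType.Exports.

Set Implicit Arguments.
Unset Strict Implicit.
Unset Printing Implicit Defensive.

Local Open Scope classical_set_scope.
Local Open Scope ring_scope.

Reserved Notation "f ** w" (at level 40, left associativity).
Reserved Notation "a '\wedge' b" (at level 45, right associativity).

(* Labels of the coordinates t, x, u_i.  The same labels index the coframe:   *)
(* Ct, Cx, Cu i stand there for dt, dx, theta^i.                              *)
Inductive jcoord : Type := Ct | Cx | Cu of nat.

Definition coord_code (c : jcoord) : option (option nat) :=
  match c with Ct => None | Cx => Some None | Cu i => Some (Some i) end.

Definition coord_decode (o : option (option nat)) : jcoord :=
  match o with None => Ct | Some None => Cx | Some (Some i) => Cu i end.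

Lemma coord_codeK : cancel coord_code coord_decode.
Proof. by case. Qed.

HB.instance Definition _ := Choice.copy jcoord (can_type coord_codeK).

(* The points (t, x, u, u_1, u_2, ...) with the product topology, and the     *)
(* real functions on them.  Functions are not bundled with a proof of         *)
(* smoothness; smoothness is a separate predicate.                            *)
Definition jet (R : realType) := {ptws jcoord -> R}.
Definition fn (R : realType) := jet R -> R.
Definition vfield (R : realType) := jcoord -> fn R.

Section Functions.
Context {R : realType}.

Definition partial (c : jcoord) (f : fn R) : fn R :=
  fun p => derive1 (fun y : R => f (dfwith p c y)) (p c).

Definition jet_order_le (N : nat) (f : fn R) :=
  forall p q : jet R, p Ct = q Ct -> p Cx = q Cx ->
    (forall i, (i <= N)%N -> p (Cu i) = q (Cu i)) -> f p = f q.

(* For a function of finitely many coordinates, continuity for the product    *)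
(* topology is joint continuity in these coordinates.                         *)
Definition smooth (f : fn R) :=
  (exists N, jet_order_le N f) /\
  forall cs : seq jcoord, let g := foldr partial f cs in
    continuous g /\
    forall (c : jcoord) (p : jet R),
      derivable (fun y : R => g (dfwith p c y)) (p c) 1.

Definition u_ (i : nat) : fn R := fun p => p (Cu i).

(* A vector field is given by its components V c, and acts on functions as    *)
(* the sum of the V c * d/dc (a finite sum on functions of finitely many      *)
(* coordinates).                                                              *)
Definition vact (V : vfield R) (f : fn R) : fn R :=
  \sum_(c \in [set: jcoord]) V c * partial c f.

(* The vector field D_x on E, written X on the equation manifold. *)
Definition total_x : vfield R :=
  fun c => match c with Ct => 0 | Cx => 1 | Cu i => u_ i.+1 end.

Definition Dx : fn R -> fn R := vact total_x.

(* pr(K d/du) *)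
Definition prolong (K : fn R) : vfield R :=
  fun c => if c is Cu i then iter i Dx K else 0.

(* T = d/dt + pr(K d/du) *)
Definition evol (K : fn R) : vfield R :=
  (fun c => (c == Ct)%:R) + prolong K.

End Functions.

(* A form is the array of its coefficients in the coframe dt, dx, theta^i:    *)
(* w [:: c_1; ...; c_k] is the value of the k-form part of w on the vectors   *)
(* c_1, ..., c_k of the dual frame.  The coframe is theta^i_E on E and        *)
(* theta^i on the equation manifold; the constructions that depend on which   *)
(* one is meant take a parameter P, see [lie].  On E the dual frame is        *)
(* d/dt, D_x, d/du_i.                                                         *)
Definition dform (R : realType) := seq jcoord -> fn R.

Section Forms.
Context {R : realType}.
Implicit Types (f K : fn R) (V : vfield R) (w a b : dform R).

Definition fscale f w : dform R := fun s => f * w s.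
Local Notation "f ** w" := (fscale f w).

Definition coframe (c : jcoord) : dform R := fun s => (s == [:: c])%:R.
Definition dt : dform R := coframe Ct.
Definition dx : dform R := coframe Cx.
Definition theta (i : nat) : dform R := coframe (Cu i).

(* Interior product with the vector c of the dual frame. *)
Definition iprod (c : jcoord) w : dform R := fun s => w (c :: s).

Definition grade_sign w : dform R := fun s => (-1) ^+ size s * w s.

(* The recursion is the rule                                                  *)
(*   c _| (a /\ b) = (c _| a) /\ b + (-1)^(deg a) a /\ (c _| b).              *)
Fixpoint wedge a b (s : seq jcoord) : fn R :=
  match s with
  | [::] => a [::] * b [::]
  | c :: s' => wedge (iprod c a) b s' + wedge (grade_sign a) (iprod c b) s'
  end.
Local Notation "a '\wedge' b" := (wedge a b).

(* The derivation of the algebra of forms that is V on functions and sends    *)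
(* the coframe element h to the 1-form A h.  The recursion is the rule        *)
(*   g _| D w = D (g _| w) + \sum_h (A h)(g) (h _| w).                        *)
Fixpoint derivation V (A : jcoord -> dform R) w (s : seq jcoord) : fn R :=
  match s with
  | [::] => vact V (w [::])
  | g :: s' => derivation V A (iprod g w) s' +
               \sum_(h \in [set: jcoord]) A h [:: g] * w (h :: s')
  end.

(* Lie derivatives, in the coframe theta^i = du_i - P i dt - u_{i+1} dx.      *)
(* [dcoord P c] is the differential of the coordinate c, [d0 P f] that of the *)
(* function f; L_V is the derivation with L_V (dz) = d (V z) for each         *)
(* coordinate z.                                                              *)
Definition dcoord (P : nat -> fn R) (c : jcoord) : dform R :=
  match c with
  | Ct => dt
  | Cx => dx
  | Cu i => theta i + P i ** dt + u_ i.+1 ** dx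
  end.

Definition d0 (P : nat -> fn R) f : dform R :=
  \sum_(c \in [set: jcoord]) partial c f ** dcoord P c.

Definition lie_coframe (P : nat -> fn R) V (c : jcoord) : dform R :=
  match c with
  | Ct => d0 P (V Ct)
  | Cx => d0 P (V Cx)
  | Cu i => d0 P (V (Cu i))
            - (vact V (P i) ** dt + P i ** d0 P (V Ct))
            - (vact V (u_ i.+1) ** dx + u_ i.+1 ** d0 P (V Cx))
  end.

Definition lie (P : nat -> fn R) V : dform R -> dform R :=
  derivation V (lie_coframe P V).

(* Equation manifold of u_t = K: theta^i = du_i - X^i(K) dt - u_{i+1} dx. *)
Definition lieR K : vfield R -> dform R -> dform R := lie (fun i => iter i Dx K).

Definition dH K w : dform R :=
  dx \wedge lieR K total_x w + dt \wedge lieR K (evol K) w.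

(* E: theta^i_E = du_i - u_{i+1} dx. *)
Definition lieE : vfield R -> dform R -> dform R := lie (fun=> 0).

Definition DxE : dform R -> dform R :=
  derivation total_x (fun c => if c is Cu i then theta i.+1 else 0).

(* As dx and the theta^i_E are killed, d_V^E only differentiates coefficients: *)
(* d_V^E (f sigma) = (d_V^E f) /\ sigma for a product sigma of coframe forms.  *)
Definition dVE w : dform R :=
  \sum_(i \in [set: nat]) (theta i \wedge (fun s => partial (Cu i) (w s))).

(* I_E on forms of type (1,s), s >= 1. *)
Definition IE (s : nat) w : dform R :=
  cst (s%:R^-1) **
  (theta 0 \wedge
   \sum_(i \in [set: nat]) iter i (fun v => - DxE v) (iprod (Cu i) w)).

(* delta_V^E on forms of type (1,s). *)
Definition deltaVE (s : nat) w : dform R := IE s.+1 (dVE w).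

Definition pi12 w : dform R :=
  fun s => if [&& size s == 3, count_mem Ct s == 0 & count_mem Cx s == 1]%N
           then w s else 0.

(* s represents the operator \sum_i s_i D_x^i. *)
Definition diff_operator (s : nat -> fn R) :=
  (forall i, smooth (s i)) /\ exists N, forall i, (N < i)%N -> s i = 0.

Definition skew_adjoint (s : nat -> fn R) :=
  forall f, smooth f ->
    \sum_(i \in [set: nat]) iter i (fun g => - Dx g) (s i * f) =
    - \sum_(i \in [set: nat]) s i * iter i Dx f.

Definition eps (s : nat -> fn R) : dform R :=
  \sum_(i \in [set: nat]) s i ** theta i.

Definition SigmaE (s : nat -> fn R) : dform R := dx \wedge theta 0 \wedge eps s.

(* For forms of type (1,2), such as [SigmaE s]. *)
Definition symplectic_form w := w <> 0 /\ deltaVE 2 w = 0.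

Definition hamiltonian K w := IE 2 (pi12 (lieE (evol K) w)) = 0.

Definition beta (n : nat) K w : dform R :=
  \sum_(1 <= i < n.+1) \sum_(1 <= a < i.+1)
    (iter a.-1 (fun v => - lieR K total_x v) (partial (Cu i) K ** w)
       \wedge theta (i - a)).

Definition omega (n : nat) K (s : nat -> fn R) : dform R :=
  dx \wedge theta 0 \wedge eps s - dt \wedge beta n K (eps s).

End Forms.

(* Main.v *)
Require Import Defs.
From HB Require Import structures.
From mathcomp Require Import all_boot all_order all_algebra.
From mathcomp Require Import all_classical all_reals all_analysis.
From mathcomp Require Import ring lra.
Import Order.TTheory GRing.Theory Num.Theory.
Import numFieldNormedType.Exports.
Local Open Scope classical_set_scope.
Local Open Scope ring_scope.

(** Write [X] for the total derivative, [T] for the evolution derivative,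
    [L_f = sum_i (df/du_i) X^i] for the linearization of [f] and [L_f^*] for its
    formal adjoint. Everything rests on the 1-form

      [rho = T eps + L_K^* eps].

    The form [beta eps] is the boundary term of the integration by parts which
    turns [L_K] into [L_K^*] ([total_x_beta]), hence

      [T (theta^0 /\ eps) + X (beta eps) = theta^0 /\ rho]

    and [dH omega = dt /\ dx /\ theta^0 /\ rho]: the form [omega] is closed exactly
    when [theta^0 /\ rho = 0] ([dH_omega_eq0]).

    The Hamiltonian condition is the same equation. The operator
    [E w = sum_i (-X)^i (d/du_i _| w)] underlying [I_E] satisfies
    [E (T w) = T (E w) + L_K^* (E w)] ([euler_evol]), and skew-adjointness gives
    [E (theta^0 /\ eps) = 2 eps] ([euler_theta0_eps]); therefore
    [E (T (theta^0 /\ eps)) = 2 rho] ([hamiltonian_iff]). The same value of [E]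
    shows that [Sigma = 0] only if [eps = 0] ([SigmaE_neq0]).

    It remains to see that [theta^0 /\ rho = 0] forces [delta_V Sigma = 0]
    ([SigmaE_closed]). The vertical differential [d_V] commutes with [X] and [T]
    ([dVE_lieV]), so that applying it to [T (theta^0 /\ eps) = - X (beta eps)] gives
    [T Phi = - X (d_V (beta eps))] with [Phi = d_V (theta^0 /\ eps)]. As [E]
    kills total derivatives ([euler_total_x]), the 2-form [w = E Phi] solves
    [T w + L_K^* w = 0]. Such a form vanishes ([evolution_kernel]): on symbols,
    where [theta^i /\ theta^j] stands for the monomial [k1^i k2^j], the leading part
    of [T + L_K^*] is multiplication by

      [dK/du_n (k1^n + k2^n + (- k1 - k2)^n)],

    which is not a zero divisor as soon as [n >= 2]. Up to a factor,
    [delta_V Sigma] is [dx /\ theta^0 /\ w].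

    A form is given by its values on lists of frame vectors, and every
    operation on forms is determined by the way it contracts with one vector.
    Identities between forms are therefore proved by induction on the list,
    from the contraction rules. *)

Set Implicit Arguments.
Unset Strict Implicit.
Unset Printing Implicit Defensive.

Local Notation "f ** w" := (fscale f w).
Local Notation "a '\wedge' b" := (wedge a b).

(** * Smooth functions on the jet space *)

Section Smooth.
Context {R : realType}.
Implicit Types (f g : fn R) (c d : jcoord) (p q : jet R).

Definition slice f c p : R -> R := fun y => f (dfwith p c y).

Definition cderivable f := forall c p, derivable (slice f c p) (p c) 1.

Lemma dfwith_id p c : dfwith p c (p c) = p.
Proof. by apply/funext => d; case: dfwithP. Qed.

Lemma dfwith_dfwith p c (y z : R) : dfwith (dfwith p c y : jet R) c z = dfwith p c z.
Proof.
apply/funext => d; have [->|cd] := eqVneq c d; first by rewrite !dfwithin.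
by rewrite !dfwithout.
Qed.

Lemma dfwithC p c d (y z : R) : c != d ->
  dfwith (dfwith p c y : jet R) d z = dfwith (dfwith p d z : jet R) c y.
Proof.
move=> cd; apply/funext => e; have [<-|ce] := eqVneq c e.
  by rewrite dfwithin dfwithout 1?eq_sym// dfwithin.
have [<-|de] := eqVneq d e; first by rewrite dfwithin dfwithout// dfwithin.
by rewrite !dfwithout.
Qed.

Lemma slice_id f c p : slice f c p (p c) = f p.
Proof. by rewrite /slice dfwith_id. Qed.

Lemma derivable_slice f c p y : cderivable f -> derivable (slice f c p) y 1.
Proof.
move=> /(_ c (dfwith p c y)); rewrite dfwithin.
suff -> : slice f c (dfwith p c y) = slice f c p by [].
by apply/funext => z; rewrite /slice dfwith_dfwith.
Qed.

Lemma partial_slice f c p y : partial c f (dfwith p c y) = derive1 (slice f c p) y.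
Proof.
rewrite /partial dfwithin.
suff -> : (fun z => f (dfwith (dfwith p c y : jet R) c z)) = slice f c p by [].
by apply/funext => z; rewrite dfwith_dfwith.
Qed.

Lemma partialE f c p : partial c f p = 'D_1 (slice f c p) (p c).
Proof. by rewrite /partial derive1E. Qed.

Lemma partialD f g c : cderivable f -> cderivable g ->
  partial c (f + g) = partial c f + partial c g.
Proof.
move=> df dg; apply/funext => p.
transitivity (partial c f p + partial c g p) => //; rewrite !partialE.
exact: deriveD (df c p) (dg c p).
Qed.

Lemma partialM f g c : cderivable f -> cderivable g ->
  partial c (f * g) = partial c f * g + f * partial c g.
Proof.
move=> df dg; apply/funext => p.
transitivity (partial c f p * g p + f p * partial c g p) => //.
rewrite !partialE addrC [X in _ + X]mulrC.
by have := deriveM (df c p) (dg c p); rewrite !slice_id.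
Qed.

Lemma partial_cst (a : R) c : partial c (cst a : fn R) = 0.
Proof. by apply/funext => p; rewrite /partial derive1_cst. Qed.

Lemma partial_coord d c : partial c (fun p => p d) = (c == d)%:R :> fn R.
Proof.
apply/funext => p; rewrite /partial.
have [->|cd] := eqVneq c d.
  under eq_fun do rewrite dfwithin.
  by rewrite derive1E derive_id.
under eq_fun do rewrite dfwithout//.
by rewrite derive1_cst.
Qed.

Lemma continuous_fnD f g : continuous f -> continuous g -> continuous (f + g).
Proof.
move=> cf cg p.
have h := @cvgD R R (jet R) (nbhs p) _ f g (f p) (g p) (cf p) (cg p).
by apply: h.
Qed.

Lemma continuous_fnM f g : continuous f -> continuous g -> continuous (f * g).
Proof.
move=> cf cg p.
have h := @cvgM R (jet R) (nbhs p) _ f g (f p) (g p) (cf p) (cg p).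
by apply: h.
Qed.

(** Smoothness bears on all iterated partial derivatives, so that the
    derivatives of a product have to be covered together with the product. Sums
    of products are stable under partial derivatives, which makes the induction
    on the list of coordinates possible. *)
Inductive smooth_closure : fn R -> Prop :=
| sc_smooth f : smooth f -> smooth_closure f
| sc_cst (a : R) : smooth_closure (cst a)
| sc_coord c : smooth_closure (fun p => p c)
| sc_add f g : smooth_closure f -> smooth_closure g -> smooth_closure (f + g)
| sc_mul f g : smooth_closure f -> smooth_closure g -> smooth_closure (f * g).

Lemma smooth_cont f : smooth f -> continuous f.
Proof. by case=> _ /(_ [::]) []. Qed.

Lemma smooth_derivable f : smooth f -> cderivable f.
Proof. by case=> _ /(_ [::]) []. Qed.

Lemma jet_orderW N M f : (N <= M)%N -> jet_order_le N f -> jet_order_le M f.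
Proof.
move=> NM fN p q pt px pu; apply: fN => // i iN; apply: pu.
exact: leq_trans iN NM.
Qed.

Lemma jet_order_partial N f c : jet_order_le N f -> jet_order_le N (partial c f).
Proof.
move=> fN p q pt px pu; rewrite /partial.
have pq y : f (dfwith p c y) = f (dfwith q c y).
  have eqc d : p d = q d -> (dfwith p c y : jet R) d = (dfwith q c y : jet R) d.
    have [->|cd] := eqVneq c d; first by rewrite !dfwithin.
    by rewrite !dfwithout.
  by apply: fN => [||i iN]; apply: eqc => //; exact: pu.
suff [->|fc]: p c = q c \/ forall y, f (dfwith q c y) = f q.
- suff -> : (fun y => f (dfwith p c y)) = (fun y => f (dfwith q c y)) by [].
  exact/funext.
- under eq_fun do rewrite pq fc.
  under [in RHS]eq_fun do rewrite fc.
  by rewrite !derive1_cst.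
case: c {pq} => [||i]; [by left|by left|].
have [iN|Ni] := leqP i N; first by left; exact: pu.
right=> y; apply: fN => [||j jN]; rewrite dfwithout//.
by apply/eqP => -[ij]; move: Ni; rewrite ij ltnNge jN.
Qed.

Lemma partial_gt_order N f i : jet_order_le N f -> (N < i)%N -> partial (Cu i) f = 0.
Proof.
move=> fN Ni; apply/funext => p; rewrite /partial.
suff -> : (fun y => f (dfwith p (Cu i) y)) = cst (f p) by rewrite derive1_cst.
apply/funext => y; apply: fN => [||j jN]; rewrite dfwithout//.
by apply/eqP => -[ij]; move: Ni; rewrite ij ltnNge jN.
Qed.

Lemma smooth_partial c f : smooth f -> smooth (partial c f).
Proof.
move=> [[N fN] sf]; split; first by exists N; exact: jet_order_partial.
by move=> cs; have := sf (rcons cs c); rewrite foldr_rcons.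
Qed.

Lemma smooth_closureP f : smooth_closure f ->
  [/\ exists N, jet_order_le N f, continuous f, cderivable f
    & forall c, smooth_closure (partial c f)].
Proof.
elim=> {f} [f sf|a|c|f g _ [[N fN] cf df pf] _ [[M gM] cg dg pg]
           |f g cf' [[N fN] cf df pf] cg' [[M gM] cg dg pg]].
- split; [by case: sf|exact: smooth_cont|exact: smooth_derivable|].
  by move=> c; apply: sc_smooth; exact: smooth_partial.
- split; [by exists 0%N|by move=> p; exact: cst_continuous| |].
    by move=> c p; exact: derivable_cst.
  by move=> c; rewrite partial_cst; exact: (sc_cst 0).
- split.
  + by case: c => [||i]; [exists 0%N..|exists i] => // p q _ _; exact.
  + by move=> p; exact: (@proj_continuous _ (fun _ : jcoord => (R : topologicalType)) c).
  + move=> d p; rewrite /slice; have [->|cd] := eqVneq d c.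
      under eq_fun do rewrite dfwithin.
      exact: derivable_id.
    under eq_fun do rewrite dfwithout//.
    exact: derivable_cst.
  + move=> d; rewrite partial_coord; case: (d == c); [exact: (sc_cst 1)|exact: (sc_cst 0)].
- split.
  + exists (maxn N M) => p q pt px pu; congr (_ + _).
      by apply: (jet_orderW (leq_maxl N M)).
    by apply: (jet_orderW (leq_maxr N M)).
  + exact: continuous_fnD.
  + by move=> c p; exact: (derivableD (df c p) (dg c p)).
  + by move=> c; rewrite partialD//; exact: sc_add.
- split.
  + exists (maxn N M) => p q pt px pu; congr (_ * _).
      by apply: (jet_orderW (leq_maxl N M)).
    by apply: (jet_orderW (leq_maxr N M)).
  + exact: continuous_fnM.
  + by move=> c p; exact: (derivableM (df c p) (dg c p)).
  + by move=> c; rewrite partialM//; apply: sc_add; exact: sc_mul.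
Qed.

Lemma smooth_closure_smooth f : smooth_closure f -> smooth f.
Proof.
move=> sf; split; first by case: (smooth_closureP sf).
move=> cs; suff /smooth_closureP [] : smooth_closure (foldr partial f cs) by [].
by elim: cs => //= c cs /smooth_closureP[].
Qed.

Lemma smoothD f g : smooth f -> smooth g -> smooth (f + g).
Proof.
by move=> sf sg; apply/smooth_closure_smooth/sc_add; exact: sc_smooth.
Qed.

Lemma smoothM f g : smooth f -> smooth g -> smooth (f * g).
Proof.
by move=> sf sg; apply/smooth_closure_smooth/sc_mul; exact: sc_smooth.
Qed.

Lemma smooth_cst (a : R) : smooth (cst a : fn R).
Proof. exact/smooth_closure_smooth/sc_cst. Qed.

Lemma smooth_coord c : smooth (fun p : jet R => p c).
Proof. exact/smooth_closure_smooth/sc_coord. Qed.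

Lemma smooth_u i : smooth (u_ i : fn R).
Proof. exact: smooth_coord. Qed.

Lemma smooth0 : smooth (0 : fn R).
Proof. exact: (smooth_cst 0). Qed.

Lemma smooth1 : smooth (1 : fn R).
Proof. exact: (smooth_cst 1). Qed.

Lemma smoothN f : smooth f -> smooth (- f).
Proof.
move=> sf; rewrite (_ : - f = cst (-1) * f); last first.
  by apply/funext => p; rewrite /= mulN1r.
exact: smoothM (smooth_cst _) sf.
Qed.

End Smooth.

Lemma smooth_order (R : realType) (f : fn R) : smooth f -> exists N, jet_order_le N f.
Proof. by case. Qed.

Lemma common_order (R : realType) (f g : fn R) : smooth f -> smooth g ->
  exists N, jet_order_le N f /\ jet_order_le N g.
Proof.
move=> [[N fN] _] [[M gM] _]; exists (maxn N M); split.
  exact: jet_orderW (leq_maxl _ _) fN.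
exact: jet_orderW (leq_maxr _ _) gM.
Qed.

(* Otherwise comparing two smoothness assumptions compares their unfoldings. *)
Global Opaque smooth.

Definition smooth_field (R : realType) (V : vfield R) := forall c, smooth (V c).

(** Redefined once the remaining operations are known to preserve smoothness. *)
Ltac smooth_hook := fail.

Ltac smooth_atom := match goal with
  | H : smooth ?f |- smooth ?f => exact H
  | H : smooth_field ?V |- smooth (?V _) => exact (H _)
  | H : forall _, smooth _ |- smooth _ => solve [apply H]
  | H : forall _ _, smooth _ |- smooth _ => solve [apply H]
  end.

(** Dispatches on the head symbol: unifying a function with a sum unfolds the
    ring structure of functions, which is slow. *)
Ltac smooth_tac := lazymatch goal with
  | |- smooth 0 => exact: smooth0
  | |- smooth 1 => exact: smooth1
  | |- smooth (u_ _) => exact: smooth_u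
  | |- smooth (cst _) => exact: smooth_cst
  | |- smooth (_ + _) => apply: smoothD; smooth_tac
  | |- smooth (- _) => apply: smoothN; smooth_tac
  | |- smooth (_ * _) => apply: smoothM; smooth_tac
  | |- smooth (partial _ _) => apply: smooth_partial; smooth_tac
  | |- smooth_field _ => first [assumption | smooth_hook]
  | |- smooth _ => first [smooth_hook | smooth_atom]
  | |- forall _, _ => let x := fresh in intro x; smooth_tac
  end.

(** * Symmetry of second derivatives *)

Section Schwarz.
Context {R : realType}.
Implicit Types (f g : fn R) (c d : jcoord) (p q : jet R).

Lemma is_derive_slice f c p (y : R) : cderivable f ->
  is_derive y (1 : R) (slice f c p) (partial c f (dfwith p c y)).
Proof.
move=> df; rewrite partial_slice derive1E.
exact/derivableP/derivable_slice.
Qed.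

Lemma slice_MVT f c p (a b : R) : cderivable f -> a < b ->
  exists2 y, a < y < b &
    f (dfwith p c b) - f (dfwith p c a) = partial c f (dfwith p c y) * (b - a).
Proof.
move=> df ab.
have d y : y \in `]a, b[ -> is_derive y (1 : R) (slice f c p) (partial c f (dfwith p c y)).
  by move=> _; exact: is_derive_slice.
have [|y] := MVT ab d.
- apply: derivable_within_continuous => y _; exact: derivable_slice.
by rewrite in_itv /= => yab e; exists y.
Qed.

Definition shift2 p c d (y z : R) : jet R := dfwith (dfwith p c y : jet R) d z.

(** The mean value theorem is applied first in the direction [c], to the
    difference of [f] in the direction [d], and then in the direction [d]. *)
Lemma second_difference f p c d (h : R) : smooth f -> c != d -> 0 < h ->
  exists y z, [/\ `|p c - y| < h, `|p d - z| < h &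
    f (shift2 p c d (p c + h) (p d + h)) - f (shift2 p c d (p c) (p d + h))
    - (f (shift2 p c d (p c + h) (p d)) - f (shift2 p c d (p c) (p d)))
    = partial d (partial c f) (shift2 p c d y z) * h * h].
Proof.
move=> sf cd h0.
pose g : fn R := fun q => f (dfwith q d (p d + h)) - f (dfwith q d (p d)).
have gE y : g (dfwith p c y) = f (shift2 p c d y (p d + h)) - f (shift2 p c d y (p d)).
  by [].
have dg (y : R) : is_derive y (1 : R) (slice g c p)
    (partial c f (shift2 p c d y (p d + h)) - partial c f (shift2 p c d y (p d))).
  have -> : slice g c p = slice f c (dfwith p d (p d + h)) - slice f c (dfwith p d (p d)).
    by apply/funext => z; rewrite /slice /g !(dfwithC _ _ _ cd).
  by rewrite /shift2 !(dfwithC _ _ _ cd); apply: is_deriveB; apply: is_derive_slice;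
     exact: smooth_derivable.
have pch : p c < p c + h by rewrite ltrDl.
have [|y + gy] := MVT pch (fun y _ => dg y).
- apply: derivable_within_continuous => y _; exact: (@ex_derive _ _ _ _ _ _ _ (dg y)).
rewrite in_itv /= => /andP[y1 y2].
have [|z /andP[z1 z2] fz] := @slice_MVT (partial c f) d (dfwith p c y) (p d) (p d + h)
   (smooth_derivable (smooth_partial c sf)).
  by rewrite ltrDl.
exists y, z; split.
- by rewrite ltr_norml; apply/andP; split; lra.
- by rewrite ltr_norml; apply/andP; split; lra.
move: gy; rewrite /slice !gE /shift2 fz => e.
transitivity (g (dfwith p c (p c + h)) - g (dfwith p c (p c))).
  by rewrite !gE /shift2; ring.
by rewrite !gE /shift2 e; ring.
Qed.

(** The topology of the jet space is that of coordinatewise convergence. *)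
Lemma cvg_jet (F : set_system (jet R)) p :
  Filter F -> (forall c, (fun q : jet R => q c) @ F --> p c) -> F --> p.
Proof.
move=> FF H; apply/cvg_sup => c; rewrite cvg_image; last first.
  by rewrite eqEsubset; split=> v // _; exists (cst v).
move=> W /H FW; exists ((fun q : jet R => q c) @^-1` W) => //.
by rewrite eqEsubset; split => [y [q ? <-//]|y Wy]; exists (fun=> y).
Qed.

Lemma shift2_cont g p c d (e : R) : continuous g -> c != d -> 0 < e ->
  exists2 h : R, 0 < h & forall y z, `|p c - y| < h -> `|p d - z| < h ->
    `|g p - g (shift2 p c d y z)| < e.
Proof.
move=> cg cd e0.
have cP : (fun v : R * R => shift2 p c d v.1 v.2) @ (p c, p d) --> p.
  apply: cvg_jet => t.
  suff : (fun v : R * R => shift2 p c d v.1 v.2 t) @ (p c, p d) --> p t by [].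
  have [->|dt] := eqVneq t d.
    rewrite /shift2; under eq_fun do rewrite dfwithin.
    exact: cvg_snd.
  have [->|ct] := eqVneq t c.
    rewrite /shift2; under eq_fun do rewrite dfwithout 1?eq_sym// dfwithin.
    exact: cvg_fst.
  rewrite /shift2; under eq_fun do rewrite dfwithout 1?eq_sym// dfwithout 1?eq_sym//.
  exact: cvg_cst.
have /cvgrPdist_lt /(_ e e0) := cvg_comp _ _ cP (cg p).
move=> /nbhs_ballP[h /= h0 H]; exists h => // y z yh zh.
by apply: (H (y, z)); split.
Qed.

Lemma no_midpoint (a b m : R) :
  `|b - m| < `|a - b| / 2 -> `|a - m| < `|a - b| / 2 -> False.
Proof. by move=> bm am; have := ler_distD m a b; rewrite (distrC m b); lra. Qed.

(** Both mixed derivatives, at points arbitrarily close to [p], equal the same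
    second difference quotient over a small square, and both are continuous. *)
Lemma partialC f c d : smooth f -> partial c (partial d f) = partial d (partial c f).
Proof.
move=> sf; have [->//|cd] := eqVneq c d; apply/funext => p.
apply/eqP; rewrite -subr_eq0 -normr_le0 leNgt; apply/negP.
set a := partial c _ p; set b := partial d _ p => ab.
have e0 : 0 < `|a - b| / 2 by lra.
have [h1 h10 H1] := shift2_cont p (smooth_cont (smooth_partial c (smooth_partial d sf))) cd e0.
have [h2 h20 H2] := shift2_cont p (smooth_cont (smooth_partial d (smooth_partial c sf))) cd e0.
have dc : d != c by rewrite eq_sym.
pose h := Num.min h1 h2.
have h0 : 0 < h by rewrite lt_min h10.
have [y1 [z1 [yh1 zh1 E1]]] := second_difference p sf cd h0.
have [z2 [y2 [zh2 yh2 E2]]] := second_difference p sf dc h0.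
have sh y z : shift2 p d c z y = shift2 p c d y z by exact: dfwithC.
move: E2; rewrite !sh => E2.
have E : partial c (partial d f) (shift2 p c d y2 z2)
       = partial d (partial c f) (shift2 p c d y1 z1).
  have hn : h != 0 by rewrite gt_eqF.
  apply: (mulIf hn); apply: (mulIf hn).
  have swap (r1 r2 r3 r4 : R) : r1 - r2 - (r3 - r4) = r1 - r3 - (r2 - r4) by ring.
  exact: (etrans (esym E2) (etrans (swap _ _ _ _) E1)).
move: yh1 zh1 yh2 zh2; rewrite !lt_min => /andP[_ yh1] /andP[_ zh1] /andP[yh2 _] /andP[zh2 _].
have := H1 _ _ yh2 zh2; have := H2 _ _ yh1 zh1; rewrite E -/a -/b.
exact: no_midpoint.
Qed.

End Schwarz.

(** * Finite sums over the coordinates *)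

Section FiniteSums.
Context {V : nmodType}.

Lemma fsum_nat (F : nat -> V) N : (forall i, (N <= i)%N -> F i = 0) ->
  \sum_(i \in [set: nat]) F i = \sum_(i < N) F i.
Proof.
move=> F0; rewrite fsbig_ord; apply/esym/fsbig_widen => // i [_ /= /negP].
by rewrite -leqNgt => /F0.
Qed.

(** Sums over all coordinates have finitely many nonzero terms; they are computed
    over these lists. *)
Definition coords N : seq jcoord := [:: Ct, Cx & [seq Cu i | i <- iota 0 N]].

Lemma coords_uniq N : uniq (coords N).
Proof.
have notu c : (forall i, c != Cu i) -> c \notin [seq Cu i | i <- iota 0 N].
  by move=> cu; apply/mapP => -[i _ e]; move: (cu i); rewrite e eqxx.
rewrite /coords /= inE negb_or !notu //=.
by rewrite map_inj_uniq ?iota_uniq// => i j [].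
Qed.

Lemma fsum_jcoord (F : jcoord -> V) N : (forall i, (N <= i)%N -> F (Cu i) = 0) ->
  \sum_(c \in [set: jcoord]) F c = \sum_(c <- coords N) F c.
Proof.
move=> F0; rewrite [RHS]fsbig_seq ?coords_uniq//; apply/esym/fsbig_widen => // c.
case: c => [||i] [_ /= ci]; [by case: ci|by case: ci|].
apply: F0; rewrite leqNgt; apply/negP => iN; apply: ci.
by rewrite /coords !inE /= map_f// mem_iota add0n iN.
Qed.

Lemma sum_coords (F : jcoord -> V) N :
  \sum_(c <- coords N) F c = F Ct + (F Cx + \sum_(i < N) F (Cu i)).
Proof.
by rewrite /coords !big_cons big_map -[N in iota 0 N]subn0 big_mkord.
Qed.

End FiniteSums.

(** * Vector fields as derivations of functions *)

Section Derivations.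
Context {R : realType}.
Implicit Types (f g : fn R) (V W : vfield R) (c d : jcoord) (p q : jet R).

Lemma smooth_sum (I : Type) (r : seq I) (P : pred I) (F : I -> fn R) :
  (forall i, smooth (F i)) -> smooth (\sum_(i <- r | P i) F i).
Proof.
move=> sF; apply: big_ind; [exact: smooth0|exact: smoothD|].
by move=> i _; exact: sF.
Qed.

Lemma smooth_partialD f g c : smooth f -> smooth g ->
  partial c (f + g) = partial c f + partial c g.
Proof. by move=> /smooth_derivable df /smooth_derivable dg; exact: partialD. Qed.

Lemma smooth_partialM f g c : smooth f -> smooth g ->
  partial c (f * g) = partial c f * g + f * partial c g.
Proof. by move=> /smooth_derivable df /smooth_derivable dg; exact: partialM. Qed.

Lemma partial0 c : partial c (0 : fn R) = 0.
Proof. exact: (partial_cst 0). Qed.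

Lemma partial1 c : partial c (1 : fn R) = 0.
Proof. exact: (partial_cst 1). Qed.

Lemma smooth_partialN f c : smooth f -> partial c (- f) = - partial c f.
Proof.
move=> sf; apply: (addrI (partial c f)).
by rewrite -smooth_partialD; [rewrite !subrr partial0|smooth_tac|smooth_tac].
Qed.

Lemma smooth_partial_sum (I : Type) (r : seq I) (F : I -> fn R) c :
  (forall i, smooth (F i)) ->
  partial c (\sum_(i <- r) F i) = \sum_(i <- r) partial c (F i).
Proof.
move=> sF; elim: r => [|i r IH]; first by rewrite !big_nil partial0.
by rewrite !big_cons smooth_partialD ?IH; [|smooth_tac|exact: smooth_sum].
Qed.

Lemma jet_orderN N f : jet_order_le N f -> jet_order_le N (- f).
Proof. by move=> fN p q pt px pu; congr (- _); exact: fN. Qed.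

Lemma jet_orderD N f g : jet_order_le N f -> jet_order_le N g -> jet_order_le N (f + g).
Proof. by move=> fN gN p q pt px pu; congr (_ + _); [exact: fN|exact: gN]. Qed.

Lemma jet_orderM N f g : jet_order_le N f -> jet_order_le N g -> jet_order_le N (f * g).
Proof. by move=> fN gN p q pt px pu; congr (_ * _); [exact: fN|exact: gN]. Qed.

Lemma jet_order_sum N (I : Type) (r : seq I) (P : pred I) (F : I -> fn R) :
  (forall i, P i -> jet_order_le N (F i)) -> jet_order_le N (\sum_(i <- r | P i) F i).
Proof.
by move=> sF; apply: big_ind => //; exact: jet_orderD.
Qed.

Lemma bounded_orders (F : nat -> fn R) N : (forall i, smooth (F i)) ->
  exists M, (N <= M)%N /\ forall i, (i < N)%N -> jet_order_le M (F i).
Proof.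
move=> sF; elim: N => [|N [M [NM FM]]]; first by exists 0%N.
have [L FL] := smooth_order (sF N).
exists (M + L).+1; split=> [|i]; first by rewrite ltnS (leq_trans NM)// leq_addr.
rewrite ltnS leq_eqVlt => /predU1P[->|iN].
  by apply: jet_orderW FL; rewrite (leq_trans (leq_addl M L)).
by apply: jet_orderW (FM i iN); rewrite (leq_trans (leq_addr L M)).
Qed.

Lemma vactE V f N : jet_order_le N f ->
  vact V f = \sum_(c <- coords N.+1) V c * partial c f.
Proof.
move=> fN; apply: fsum_jcoord => i Ni.
by rewrite (partial_gt_order fN Ni) mulr0.
Qed.

Lemma smooth_vact V f : smooth_field V -> smooth f -> smooth (vact V f).
Proof.
move=> sV sf; have [N fN] := smooth_order sf; rewrite (vactE _ fN).
by apply: smooth_sum; smooth_tac.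
Qed.

Lemma vact_cst V (a : R) : vact V (cst a) = 0.
Proof. by apply: fsbig1 => c _; rewrite partial_cst mulr0. Qed.

Lemma vact0 V : vact V 0 = 0. Proof. exact: vact_cst. Qed.
Lemma vact1 V : vact V 1 = 0. Proof. exact: vact_cst. Qed.

Lemma vact_coord V c : vact V (fun p => p c) = V c.
Proof.
rewrite /vact -(fsbig_widen [set c])//; last first.
  by move=> d [_ /eqP/negbTE dc]; rewrite /= partial_coord dc mulr0.
by rewrite fsbig_set1 partial_coord eqxx mulr1.
Qed.

Lemma vactD V f g : smooth f -> smooth g -> vact V (f + g) = vact V f + vact V g.
Proof.
move=> sf sg; have [N [fN gN]] := common_order sf sg.
rewrite !(vactE _ fN) !(vactE _ gN) (vactE _ (jet_orderD fN gN)) -big_split /=.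
by apply: eq_bigr => c _; rewrite smooth_partialD// mulrDr.
Qed.

Lemma vactN V f : smooth f -> vact V (- f) = - vact V f.
Proof.
move=> sf; apply: (addrI (vact V f)).
by rewrite -vactD; [rewrite !subrr vact0|smooth_tac|smooth_tac].
Qed.

Lemma vactM V f g : smooth f -> smooth g -> vact V (f * g) = vact V f * g + f * vact V g.
Proof.
move=> sf sg; have [N [fN gN]] := common_order sf sg.
rewrite (vactE _ fN) (vactE _ gN) (vactE _ (jet_orderM fN gN)).
rewrite mulr_suml mulr_sumr -big_split /=.
apply: eq_bigr => c _; rewrite smooth_partialM// mulrDr mulrA; congr (_ + _); exact: mulrCA.
Qed.

Lemma vact_sum V (I : Type) (r : seq I) (F : I -> fn R) : (forall i, smooth (F i)) ->
  vact V (\sum_(i <- r) F i) = \sum_(i <- r) vact V (F i).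
Proof.
move=> sF; elim: r => [|i r IH]; first by rewrite !big_nil vact0.
by rewrite !big_cons vactD ?IH; [|smooth_tac|exact: smooth_sum].
Qed.

(** The bound on the order does not depend on the function; this is what keeps
    the order of the coefficients of a form uniform. *)
Lemma jet_order_vact V N : smooth_field V ->
  exists2 M, (N <= M)%N & forall f, jet_order_le N f -> jet_order_le M (vact V f).
Proof.
move=> sV; have [M1 [_ VM1]] := bounded_orders N.+1 (fun i => sV (Cu i)).
have [M2 [M2t M2x]] := common_order (sV Ct) (sV Cx).
exists (N + (M1 + M2))%N; first exact: leq_addr.
move=> f fN; rewrite (vactE _ fN) sum_coords.
have fM c : jet_order_le (N + (M1 + M2)) (partial c f).
  by apply: jet_order_partial; apply: jet_orderW fN; exact: leq_addr.
have M2le : (M2 <= N + (M1 + M2))%N by rewrite addnA leq_addl.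
have M1le : (M1 <= N + (M1 + M2))%N by rewrite addnCA leq_addr.
apply: jet_orderD; last apply: jet_orderD.
- by apply: jet_orderM => //; exact: jet_orderW M2t.
- by apply: jet_orderM => //; exact: jet_orderW M2x.
- by apply: jet_order_sum => i _; apply: jet_orderM => //; apply: (jet_orderW M1le); apply: VM1.
Qed.

(** The bracket of [d/dz] with [V] has the components [dV^c/dz]. *)
Lemma partial_vact V f c : smooth_field V -> smooth f ->
  partial c (vact V f) = vact V (partial c f) + vact (fun d => partial c (V d)) f.
Proof.
move=> sV sf; have [N fN] := smooth_order sf.
rewrite (vactE _ fN) (vactE _ (jet_order_partial _ fN)) (vactE _ fN).
rewrite smooth_partial_sum; last by smooth_tac.
rewrite -big_split /=; apply: eq_bigr => d _.
rewrite smooth_partialM; [|smooth_tac|smooth_tac].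
by rewrite addrC (partialC c d sf).
Qed.

(** The second order parts of [VW] and [WV] agree by symmetry of the second
    derivatives; the first order parts are compared on the coordinates. *)
Lemma vact_comm V W f : smooth_field V -> smooth_field W -> smooth f ->
  (forall c, vact V (W c) = vact W (V c)) ->
  vact V (vact W f) = vact W (vact V f).
Proof.
move=> sV sW sf VW; have [N fN] := smooth_order sf.
have H A B : smooth_field A -> smooth_field B -> vact A (vact B f) =
    \sum_(c <- coords N.+1) vact A (B c) * partial c f +
    \sum_(c <- coords N.+1) \sum_(d <- coords N.+1)
       B c * (A d * partial d (partial c f)).
  move=> sA sB; rewrite (vactE B fN) vact_sum; last by smooth_tac.
  rewrite -big_split /=; apply: eq_bigr => c _.
  rewrite vactM; [|smooth_tac|smooth_tac].
  by rewrite (vactE A (jet_order_partial _ fN)) mulr_sumr.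
rewrite (H V W sV sW) (H W V sW sV); congr (_ + _).
  by apply: eq_bigr => c _; rewrite VW.
rewrite exchange_big; apply: eq_bigr => c _; apply: eq_bigr => d _.
by rewrite (partialC c d sf); exact: mulrCA.
Qed.

End Derivations.

(** * The total derivative and the evolution field *)

Section EvolutionFields.
Context {R : realType}.
Implicit Types (f g K : fn R).

Lemma smooth_total_x : smooth_field (@total_x R).
Proof. by case=> [||i] /=; smooth_tac. Qed.

Lemma smooth_Dx f : smooth f -> smooth (Dx f).
Proof. move=> sf; exact: (smooth_vact smooth_total_x sf). Qed.

Lemma smooth_iterDx i f : smooth f -> smooth (iter i Dx f).
Proof. by move=> sf; elim: i => [|i IH] /=; [exact: sf|exact: (smooth_Dx IH)]. Qed.

Lemma smooth_evol K : smooth K -> smooth_field (evol K).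
Proof.
move=> sK c; apply: smoothD; first by case: (c == Ct); [exact: smooth1|exact: smooth0].
by case: c => [||i] /=; [smooth_tac|smooth_tac|exact: smooth_iterDx].
Qed.

Lemma evolE K c : evol K c = (c == Ct)%:R + prolong K c.
Proof. by []. Qed.

Lemma evolCt K : evol K Ct = 1.
Proof. by rewrite evolE eqxx /= addr0. Qed.

Lemma evolCx K : evol K Cx = 0.
Proof. by rewrite evolE /= addr0. Qed.

Lemma evolCu K i : evol K (Cu i) = iter i Dx K.
Proof. by rewrite evolE /= add0r. Qed.

Lemma vact_u V i : vact V (u_ i : fn R) = V (Cu i).
Proof. exact: vact_coord. Qed.

Lemma partial_u c i : partial c (u_ i : fn R) = (c == Cu i)%:R.
Proof. exact: partial_coord. Qed.

(** The coordinate [u_(i+1)] occurs in [D_x] only as the coefficient of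
    [d/du_i]. *)
Lemma partial_Dx c f : smooth f ->
  partial c (Dx f) = Dx (partial c f) + (if c is Cu i.+1 then partial (Cu i) f else 0).
Proof.
move=> sf; rewrite (partial_vact c smooth_total_x sf).
congr (_ + _); have Z d : partial c (@total_x R d) =
    (if (c, d) is (Cu i.+1, Cu j) then (i == j)%:R else 0).
  case: d => [||j] /=; rewrite ?partial0 ?partial1; try by case: c => [||[]].
  rewrite partial_u; case: c => [||[|i]]; [by []|by []|by []|].
  suff -> : (Cu i.+1 == Cu j.+1) = (i == j) by [].
  by apply/eqP/eqP => [[]//|->].
rewrite /vact; under eq_fsbigr do rewrite Z.
case: c {Z} => [||[|i]]; try by apply: fsbig1 => d _; rewrite mul0r.
rewrite -(fsbig_widen [set Cu i])// ?fsbig_set1 ?eqxx ?mul1r//.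
move=> d [_ /= di]; case: d di => [||j ij]; rewrite ?mul0r//.
suff /negbTE -> : i != j by rewrite mul0r.
by apply/eqP => e; apply: ij; rewrite e.
Qed.

End EvolutionFields.

(** * Exterior products *)

Section Wedge.
Context {R : realType}.
Implicit Types (f : fn R) (a b w : dform R) (c d g : jcoord) (s : seq jcoord).

Lemma formDE a b s : (a + b) s = a s + b s. Proof. by []. Qed.
Lemma formNE a s : (- a) s = - a s. Proof. by []. Qed.
Lemma form0E s : (0 : dform R) s = 0. Proof. by []. Qed.
Lemma form_sumE (I : Type) (r : seq I) (P : pred I) (F : I -> dform R) s :
  (\sum_(i <- r | P i) F i) s = \sum_(i <- r | P i) F i s.
Proof.
by apply: (big_morph (fun w : dform R => w s)) => //.
Qed.

Lemma sum_formD (I : Type) (r : seq I) (F G : I -> dform R) :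
  \sum_(i <- r) (F i + G i) = \sum_(i <- r) F i + \sum_(i <- r) G i.
Proof. exact: big_split. Qed.

Lemma iprodD c a b : iprod c (a + b) = iprod c a + iprod c b. Proof. by []. Qed.
Lemma iprodN c a : iprod c (- a) = - iprod c a. Proof. by []. Qed.
Lemma iprod0 c : iprod c (0 : dform R) = 0. Proof. by []. Qed.
Lemma iprodZ c f a : iprod c (f ** a) = f ** iprod c a. Proof. by []. Qed.
Lemma iprod_sum c (I : Type) (r : seq I) (P : pred I) (F : I -> dform R) :
  iprod c (\sum_(i <- r | P i) F i) = \sum_(i <- r | P i) iprod c (F i).
Proof. by apply/funext => s; rewrite /iprod !form_sumE. Qed.

Lemma fscaleDr f a b : f ** (a + b) = f ** a + f ** b.
Proof. by apply/funext => s; exact: mulrDr. Qed.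
Lemma fscaleDl f f' a : (f + f') ** a = f ** a + f' ** a.
Proof. by apply/funext => s; exact: mulrDl. Qed.
Lemma fscaleA f f' a : (f * f') ** a = f ** (f' ** a).
Proof. by apply/funext => s; rewrite /fscale -mulrA. Qed.
Lemma fscaleN f a : f ** (- a) = - (f ** a).
Proof. by apply/funext => s; exact: mulrN. Qed.
Lemma fscale0r f : f ** (0 : dform R) = 0.
Proof. by apply/funext => s; exact: mulr0. Qed.
Lemma fscale0l a : 0 ** a = 0.
Proof. by apply/funext => s; exact: mul0r. Qed.
Lemma fscale1 a : 1 ** a = a.
Proof. by apply/funext => s; exact: mul1r. Qed.
Lemma fscale_sumr f (I : Type) (r : seq I) (P : pred I) (F : I -> dform R) :
  f ** (\sum_(i <- r | P i) F i) = \sum_(i <- r | P i) f ** F i.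
Proof.
by apply: (big_morph (fscale f)); [exact: fscaleDr|exact: fscale0r].
Qed.
Lemma fscale_suml a (I : Type) (r : seq I) (P : pred I) (F : I -> fn R) :
  (\sum_(i <- r | P i) F i) ** a = \sum_(i <- r | P i) F i ** a.
Proof.
by apply: (big_morph (fun f => f ** a)); [move=> x y; exact: fscaleDl|exact: fscale0l].
Qed.

Lemma grade_signD a b : grade_sign (a + b) = grade_sign a + grade_sign b.
Proof. by apply/funext => s; exact: mulrDr. Qed.
Lemma iprod_grade_sign c a : iprod c (grade_sign a) = - grade_sign (iprod c a).
Proof. by apply/funext => s; rewrite /iprod /grade_sign /= exprS mulN1r mulNr. Qed.

Lemma wedgeDl a a' b : (a + a') \wedge b = a \wedge b + a' \wedge b.
Proof.
apply/funext => s; elim: s a a' b => [|c s IH] a a' b /=; first exact: mulrDl.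
by rewrite iprodD grade_signD !IH addrACA.
Qed.

Lemma wedgeDr a b b' : a \wedge (b + b') = a \wedge b + a \wedge b'.
Proof.
apply/funext => s; elim: s a b b' => [|c s IH] a b b' /=; first exact: mulrDr.
by rewrite iprodD !IH addrACA.
Qed.

Lemma wedge0l b : 0 \wedge b = 0.
Proof. by apply: (addrI (0 \wedge b)); rewrite -wedgeDl !addr0. Qed.
Lemma wedge0r a : a \wedge 0 = 0.
Proof. by apply: (addrI (a \wedge 0)); rewrite -wedgeDr !addr0. Qed.
Lemma wedgeNl a b : (- a) \wedge b = - (a \wedge b).
Proof. by apply: (addrI (a \wedge b)); rewrite -wedgeDl !subrr wedge0l. Qed.
Lemma wedgeNr a b : a \wedge (- b) = - (a \wedge b).
Proof. by apply: (addrI (a \wedge b)); rewrite -wedgeDr !subrr wedge0r. Qed.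
Lemma wedge_sumr a (I : Type) (r : seq I) (P : pred I) (F : I -> dform R) :
  a \wedge (\sum_(i <- r | P i) F i) = \sum_(i <- r | P i) (a \wedge F i).
Proof.
by apply: (big_morph (wedge a)); [exact: wedgeDr|exact: wedge0r].
Qed.
Lemma wedgeZr a b f : a \wedge (f ** b) = f ** (a \wedge b).
Proof.
apply/funext => s; elim: s a b => [|c s IH] a b /=.
  by rewrite /fscale; exact: mulrCA.
by rewrite iprodZ !IH; apply/esym/mulrDr.
Qed.

(** A list of length 0 carries the coefficient of a 0-form, hence the encoding of a
    function as a form. *)
Lemma wedge_fun f b : (fun s => if s is [::] then f else 0) \wedge b = f ** b.
Proof.
apply/funext => s; elim: s b => [|c s IH] b //=.
rewrite [X in X \wedge b](_ : _ = 0)// wedge0l add0r.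
rewrite [X in X \wedge _](_ : _ = (fun s => if s is [::] then f else 0)) ?IH//.
apply/funext => -[|c' s']; first by rewrite /grade_sign expr0 mul1r.
by rewrite /grade_sign mulr0.
Qed.

Lemma grade_sign_coframe c : grade_sign (coframe c) = - coframe c :> dform R.
Proof.
apply/funext => -[|d [|d' s]]; rewrite /grade_sign /coframe formNE.
- by rewrite mulr0 oppr0.
- by rewrite expr1 mulN1r.
- by rewrite [_ == _](_ : _ = false) ?mulr0 ?oppr0// eqseq_cons andbF.
Qed.

Lemma coframe_wedge_nil c b : (coframe c \wedge b) [::] = 0.
Proof. by rewrite /= /coframe mul0r. Qed.

Lemma iprod_coframe g c :
  iprod g (coframe c) = (fun s => if s is [::] then (g == c)%:R else 0) :> dform R.
Proof.
apply/funext => -[|d s]; rewrite /iprod /coframe eqseq_cons ?andbT//.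
by rewrite andbF.
Qed.

Lemma wedge_cons a b c s : (a \wedge b) (c :: s) =
  (iprod c a \wedge b) s + (grade_sign a \wedge iprod c b) s.
Proof. by []. Qed.

(** All products below have a coframe element as left factor. This rule and the
    vanishing on the empty list determine them. *)
Lemma iprod_coframe_wedge g c b :
  iprod g (coframe c \wedge b) = (if g == c then b else 0) - coframe c \wedge iprod g b.
Proof.
apply/funext => s; rewrite [LHS]wedge_cons formDE iprod_coframe wedge_fun.
rewrite grade_sign_coframe wedgeNl; congr (_ + _); case: ifP => _.
  by rewrite fscale1.
by rewrite fscale0l.
Qed.

Lemma coframe_wedgeC c d b :
  coframe c \wedge coframe d \wedge b = - (coframe d \wedge coframe c \wedge b).
Proof.
apply/funext => s; elim: s b => [|g s IH] b.
  by rewrite formNE !coframe_wedge_nil oppr0.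
rewrite formNE; transitivity (iprod g (coframe c \wedge coframe d \wedge b) s) => //.
transitivity (- (iprod g (coframe d \wedge coframe c \wedge b) s)) => //.
rewrite !iprod_coframe_wedge !wedgeDr !wedgeNr !(formDE, formNE) (IH (iprod g b)) !formNE.
have H (x : jcoord) w : (coframe x \wedge (if g == c then w else 0)) =
   if g == c then coframe x \wedge w else 0 by case: ifP => // _; rewrite wedge0r.
have H' (x : jcoord) w : (coframe x \wedge (if g == d then w else 0)) =
   if g == d then coframe x \wedge w else 0 by case: ifP => // _; rewrite wedge0r.
rewrite H H' !opprD !opprK !addrA; congr (_ + _); exact: addrC.
Qed.

Lemma coframe_wedge2 c b : coframe c \wedge coframe c \wedge b = 0.
Proof.
apply/funext => s; elim: s b => [|g s IH] b; first exact: coframe_wedge_nil.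
transitivity (iprod g (coframe c \wedge coframe c \wedge b) s) => //.
rewrite !iprod_coframe_wedge !wedgeDr !wedgeNr !(formDE, formNE) IH !form0E subr0.
by case: ifP => _; rewrite ?wedge0r subrr.
Qed.

(** A coframe element moves across a form at the cost of the sign of its degree. *)
Lemma wedge_coframe_r a c : a \wedge coframe c = coframe c \wedge grade_sign a.
Proof.
apply/funext => s; elim: s a => [|g s IH] a.
  by rewrite coframe_wedge_nil /= /coframe mulr0.
transitivity (iprod g (coframe c \wedge grade_sign a) s) => //.
rewrite iprod_coframe_wedge iprod_grade_sign wedgeNr opprK formDE /= IH addrC.
congr (_ + _); rewrite iprod_coframe.
elim: s (grade_sign a) {IH} => [|d s IH] b /=.
  by case: (g == c) => /=; rewrite ?mulr1 ?mulr0.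
rewrite [X in _ + wedge _ X s](_ : _ = 0) ?wedge0r ?addr0//.
by rewrite IH; case: (g == c).
Qed.

Definition is_vertical c := if c is Cu _ then true else false.

(** Sums of functions times [k]-fold products of the [theta^i]. *)
Definition vertical_form k w :=
  forall s, ~~ ((size s == k) && all is_vertical s) -> w s = 0.

Lemma vertical_formD k a b : vertical_form k a -> vertical_form k b -> vertical_form k (a + b).
Proof. by move=> ka kb s ks; rewrite formDE ka// kb// addr0. Qed.

Lemma vertical_formN k a : vertical_form k a -> vertical_form k (- a).
Proof. by move=> ka s ks; rewrite formNE ka// oppr0. Qed.

Lemma vertical_formZ k f a : vertical_form k a -> vertical_form k (f ** a).
Proof. by move=> ka s ks; rewrite /fscale ka// mulr0. Qed.

Lemma vertical_form_sum k (I : Type) (r : seq I) (P : pred I) (F : I -> dform R) :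
  (forall i, vertical_form k (F i)) -> vertical_form k (\sum_(i <- r | P i) F i).
Proof. by move=> kF; apply: big_ind => //; exact: vertical_formD. Qed.

Lemma vertical_iprod k g w : vertical_form k.+1 w -> vertical_form k (iprod g w).
Proof.
move=> kw s ks; apply: kw => /=; rewrite eqSS; apply: contra ks.
by move=> /and3P[-> _ ->].
Qed.

Lemma vertical_iprod_eq0 k g w : vertical_form k w -> ~~ is_vertical g || (k == 0%N) ->
  iprod g w = 0.
Proof.
move=> kw gk; apply/funext => s; apply: (kw (g :: s)) => /=; clear kw; case: k gk => [|k]; first by [].
by rewrite orbF => /negbTE ->; rewrite andbF.
Qed.

Lemma vertical_coframe_wedge k i w : vertical_form k w ->
  vertical_form k.+1 (coframe (Cu i) \wedge w).
Proof.
move=> kw s; elim: s k w kw => [|g s IH] k w kw.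
  by rewrite coframe_wedge_nil.
move=> gs; transitivity (iprod g (coframe (Cu i) \wedge w) s) => //.
rewrite iprod_coframe_wedge formDE formNE.
case: k kw gs => [|k] kw gs.
  rewrite (vertical_iprod_eq0 kw) ?orbT// wedge0r oppr0 addr0.
  case: eqP => // gE; apply: kw; move: gs; rewrite gE /= eqSS.
  by apply: contra => /andP[-> ->].
have -> : (if g == Cu i then w else 0) s = 0.
  case: eqP => // gE; apply: kw; move: gs; rewrite gE /= eqSS.
  by apply: contra => /andP[-> ->].
case gv : (is_vertical g); last first.
  by rewrite (vertical_iprod_eq0 kw) ?gv// wedge0r subr0.
rewrite (IH k) ?subr0//; first exact: vertical_iprod.
by move: gs; rewrite /= gv eqSS.
Qed.

Lemma grade_sign_vertical1 a : vertical_form 1 a -> grade_sign a = - a.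
Proof.
move=> a1; apply/funext => s; rewrite /grade_sign formNE.
case s1 : (size s == 1%N); first by rewrite (eqP s1) expr1 mulN1r.
by rewrite a1 ?s1// mulr0 oppr0.
Qed.

(** An array of coefficients need not be skew-symmetric. Skew-symmetry is what
    allows two contractions to be exchanged, see [iprod_iprod]. *)
Definition skew_form w :=
  forall r c d s, w (r ++ [:: c, d & s]) = - w (r ++ [:: d, c & s]).

Lemma skew_form_iprod c w : skew_form w -> skew_form (iprod c w).
Proof. by move=> aw r; exact: (aw (c :: r)). Qed.

Lemma skew_formD a b : skew_form a -> skew_form b -> skew_form (a + b).
Proof. by move=> aa ab r c d s; rewrite !formDE aa ab opprD. Qed.

Lemma skew_formN a : skew_form a -> skew_form (- a).
Proof. by move=> aa r c d s; rewrite !formNE aa. Qed.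

Lemma skew_form_sum (I : Type) (r : seq I) (P : pred I) (F : I -> dform R) :
  (forall i, skew_form (F i)) -> skew_form (\sum_(i <- r | P i) F i).
Proof.
move=> aF; apply: big_ind => //; last exact: skew_formD.
by move=> ? ? ? ?; rewrite !form0E oppr0.
Qed.

Lemma skew_form_vertical1 a : vertical_form 1 a -> skew_form a.
Proof.
move=> a1 r c d s; rewrite !a1 ?oppr0// size_cat /= !addnS eqSS //=.
Qed.

Lemma iprod_iprod c d w : skew_form w -> iprod c (iprod d w) = - iprod d (iprod c w).
Proof. by move=> aw; apply/funext => s; exact: (aw [::]). Qed.

Lemma skew_form_coframe_wedge c w : skew_form w -> skew_form (coframe c \wedge w).
Proof.
move=> aw r; elim: r w aw => [|g r IH] w aw d d' s.
  transitivity (iprod d' (iprod d (coframe c \wedge w)) s) => //.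
  transitivity (- (iprod d (iprod d' (coframe c \wedge w)) s)) => //.
  rewrite !iprod_coframe_wedge !iprodD !iprodN !iprod_coframe_wedge.
  rewrite (iprod_iprod _ _ aw) wedgeNr.
  rewrite !(formDE, formNE) !opprD !opprK addrA addrA; congr (_ + _).
  case: (d == c); case: (d' == c); rewrite ?iprod0 ?form0E ?oppr0 ?addr0 ?add0r//.
  exact: addrC.
have E u : (coframe c \wedge w) ((g :: r) ++ u) = iprod g (coframe c \wedge w) (r ++ u) by [].
rewrite !E iprod_coframe_wedge !(formDE, formNE) opprD.
rewrite (IH _ (skew_form_iprod g aw)); congr (_ + _).
by case: (g == c); [exact: aw|rewrite !form0E oppr0].
Qed.

End Wedge.

(** * Forms with finitely many coefficients *)

Section TameForms.
Context {R : realType}.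
Implicit Types (f : fn R) (V W : vfield R) (a b w : dform R) (c d g : jcoord).

(** The bounds on the coordinates that occur in the coefficients and on the
    [theta^i] that occur in the form are uniform: all sums over coordinates that
    define the operations on forms are then finite sums with a common bound. *)
Definition tame_le N w := [/\ forall s, smooth (w s), forall s, jet_order_le N (w s)
  & forall i s, (N <= i)%N -> Cu i \in s -> w s = 0].

Definition tame w := exists N, tame_le N w.

Lemma tame_leW N M w : (N <= M)%N -> tame_le N w -> tame_le M w.
Proof.
move=> NM [sw ow zw]; split=> // [s|i s Mi]; first exact: jet_orderW (ow s).
by apply: zw; exact: leq_trans Mi.
Qed.

Lemma tame_smooth w s : tame w -> smooth (w s).
Proof. by case=> N []. Qed.

Lemma common_tame a b : tame a -> tame b -> exists N, tame_le N a /\ tame_le N b.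
Proof.
move=> [N Na] [M Mb]; exists (maxn N M); split.
  exact: tame_leW (leq_maxl _ _) Na.
exact: tame_leW (leq_maxr _ _) Mb.
Qed.

Lemma tame_le0 N : tame_le N 0.
Proof. by split=> // s; exact: smooth0. Qed.

Lemma tame_leD N a b : tame_le N a -> tame_le N b -> tame_le N (a + b).
Proof.
move=> [sa oa za] [sb ob zb]; split=> [s|s|i s Ni us].
- exact: smoothD.
- exact: jet_orderD.
- by rewrite formDE (za i) ?(zb i) ?addr0.
Qed.

Lemma tame_leN N a : tame_le N a -> tame_le N (- a).
Proof.
move=> [sa oa za]; split=> [s|s|i s Ni us].
- exact: smoothN.
- exact: jet_orderN.
- by rewrite formNE (za i) ?oppr0.
Qed.

Lemma tame_leZ N f a : smooth f -> jet_order_le N f -> tame_le N a -> tame_le N (f ** a).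
Proof.
move=> sf fN [sa oa za]; split=> [s|s|i s Ni us].
- exact: (smoothM sf (sa s)).
- exact: (jet_orderM fN (oa s)).
- by rewrite /fscale (za i) ?mulr0.
Qed.

Lemma tame_le_iprod N c a : tame_le N a -> tame_le N (iprod c a).
Proof.
move=> [sa oa za]; split=> [s|s|i s Ni us]; [exact: sa|exact: oa|].
by apply: (za i) => //; rewrite inE us orbT.
Qed.

Lemma tame_le_coframe_wedge N c a : (forall i, c = Cu i -> (i < N)%N) ->
  tame_le N a -> tame_le N (coframe c \wedge a).
Proof.
move=> cN aN.
have E g s w : (coframe c \wedge w) (g :: s) =
    (if g == c then w s else 0) - (coframe c \wedge iprod g w) s.
  transitivity (iprod g (coframe c \wedge w) s) => //.
  by rewrite iprod_coframe_wedge formDE; case: ifP.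
split=> [s|s|i s Ni].
- elim: s a aN => [|g s IH] a aN; first by rewrite coframe_wedge_nil; smooth_tac.
  rewrite E; apply: smoothD; last by apply/smoothN/IH; exact: tame_le_iprod.
  by case: ifP => _; [case: aN => + _ _; exact|smooth_tac].
- elim: s a aN => [|g s IH] a aN; first by rewrite coframe_wedge_nil.
  rewrite E; apply: jet_orderD; last by apply/jet_orderN/IH; exact: tame_le_iprod.
  by case: ifP => _ //; case: aN => _ + _; exact.
- elim: s a aN => [//|g s IH] a aN; rewrite inE E => /predU1P[ig|us].
    rewrite -ig; case: eqP => [ci|_].
      by move: (cN i (esym ci)); rewrite ltnNge Ni.
    rewrite (_ : iprod (Cu i) a = 0) ?wedge0r ?form0E ?subr0//.
    by case: aN => _ _ za; apply/funext => r; apply: (za i) => //; rewrite inE eqxx.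
  rewrite IH//; last exact: tame_le_iprod.
  by rewrite subr0; case: ifP => // _; case: aN => _ _ za; exact: (za i).
Qed.

Lemma tame0 : tame 0.
Proof. by exists 0%N; exact: tame_le0. Qed.

Lemma tameD a b : tame a -> tame b -> tame (a + b).
Proof. by move=> ta tb; have [N [aN bN]] := common_tame ta tb; exists N; exact: tame_leD. Qed.

Lemma tameN a : tame a -> tame (- a).
Proof. by move=> [N aN]; exists N; exact: tame_leN. Qed.

Lemma tameZ f a : smooth f -> tame a -> tame (f ** a).
Proof.
move=> sf [N aN]; have [M fM] := smooth_order sf; exists (maxn N M).
apply: (tame_leZ sf); first exact: jet_orderW (leq_maxr _ _) fM.
exact: tame_leW (leq_maxl _ _) aN.
Qed.

Lemma tame_iprod c a : tame a -> tame (iprod c a).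
Proof. by move=> [N aN]; exists N; exact: tame_le_iprod. Qed.

Lemma tame_sum (I : Type) (r : seq I) (P : pred I) (F : I -> dform R) :
  (forall i, P i -> tame (F i)) -> tame (\sum_(i <- r | P i) F i).
Proof. by move=> tF; apply: big_ind => //; [exact: tame0|exact: tameD]. Qed.

Lemma tame_coframe_wedge c a : tame a -> tame (coframe c \wedge a).
Proof.
move=> [N aN]; pose M := if c is Cu i then maxn N i.+1 else N; exists M.
apply: tame_le_coframe_wedge => [i ci|].
  by rewrite /M ci leq_maxr.
apply: tame_leW aN; rewrite /M; case: c {M} => // i; exact: leq_maxl.
Qed.

Definition cpartial c w : dform R := fun s => partial c (w s).

Lemma tame_le_cpartial N c w : tame_le N w -> tame_le N (cpartial c w).
Proof.
move=> [sw ow zw]; split=> [s|s|i s Ni us].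
- exact: smooth_partial.
- exact: jet_order_partial.
- by rewrite /cpartial (zw i) ?partial0.
Qed.

Lemma tame_cpartial c a : tame a -> tame (cpartial c a).
Proof. by move=> [N aN]; exists N; exact: tame_le_cpartial. Qed.

Lemma tame_theta f i : smooth f -> tame (f ** theta i).
Proof.
move=> sf; apply: tameZ => //; exists i.+1; split=> [s|s|j s ij us].
- rewrite /theta /coframe; case: (s == [:: Cu i]); [exact: smooth1|exact: smooth0].
- by rewrite /theta /coframe; case: (s == [:: Cu i]).
- rewrite /theta /coframe; case: eqP => // e; move: us; rewrite e inE => /eqP[ji].
  by move: ij; rewrite ji ltnn.
Qed.

End TameForms.

Ltac tame_hook := fail.

Ltac tame_tac := lazymatch goal with
  | |- tame 0 => exact: tame0
  | |- tame (_ + _) => apply: tameD; tame_tac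
  | |- tame (- _) => apply: tameN; tame_tac
  | |- tame (_ ** _) => apply: tameZ; [smooth_tac|tame_tac]
  | |- tame (iprod _ _) => apply: tame_iprod; tame_tac
  | |- tame (wedge (coframe _) _) => apply: tame_coframe_wedge; tame_tac
  | |- tame (wedge (theta _) _) => apply: tame_coframe_wedge; tame_tac
  | |- tame (cpartial _ _) => apply: tame_cpartial; tame_tac
  | |- tame (\sum_(_ <- _ | _) _) => apply: tame_sum => ? _; tame_tac
  | |- tame (if _ then _ else _) => case: ifP => _; tame_tac
  | |- tame _ => first [tame_hook | match goal with
      | H : tame ?w |- tame ?w => exact H
      | H : forall _, tame _ |- tame _ => solve [apply H]
      end]
  | |- forall _, _ => let x := fresh in intro x; tame_tac
  end.

(** * Derivative of a form along a field *)

Section LieDerivative.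
Context {R : realType}.
Implicit Types (f : fn R) (V W : vfield R) (a b w : dform R) (c d g : jcoord).

(** Derivation along [V] sends [theta^i] to [sum_j (dV^i/du_j) theta^j], modulo
    forms that vanish under the assumptions made on [V], see
    [lie_coframe_vjac]. *)
Definition vjac V (h g : jcoord) : fn R :=
  if (h, g) is (Cu i, Cu j) then partial (Cu j) (V (Cu i)) else 0.

Definition lieV V : dform R -> dform R :=
  derivation V (fun h s => if s is [:: g] then vjac V h g else 0).

(** The components along [d/dt] and [d/dx] are constant, so that [V] acts on [dt]
    and [dx] by zero. *)
Definition contact_field V := smooth_field V /\
  forall c d, ~~ is_vertical c -> partial d (V c) = 0.

(** The failure of the derivation along [V] to commute with contraction. *)
Definition lie_corr V g w : dform R :=
  fun s => \sum_(h \in [set: jcoord]) vjac V h g * w (h :: s).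

Lemma lieV_nil V w : lieV V w [::] = vact V (w [::]). Proof. by []. Qed.

Lemma iprod_lieV V g w : iprod g (lieV V w) = lieV V (iprod g w) + lie_corr V g w.
Proof. by []. Qed.

Lemma lie_corrE N V g w : (forall i s, (N <= i)%N -> w (Cu i :: s) = 0) ->
  lie_corr V g w = \sum_(i < N) vjac V (Cu i) g ** iprod (Cu i) w.
Proof.
move=> wN; apply/funext => s; rewrite form_sumE /lie_corr.
rewrite (@fsum_jcoord _ _ N) ?sum_coords.
  by rewrite !mul0r !add0r.
by move=> i Ni; rewrite wN// mulr0.
Qed.

Lemma tame_lie_corrE N M V g w : tame_le N w -> (N <= M)%N ->
  lie_corr V g w = \sum_(i < M) vjac V (Cu i) g ** iprod (Cu i) w.
Proof.
move=> [_ _ zw] NM; apply: lie_corrE => i s Mi.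
by apply: (zw i); [exact: leq_trans Mi|rewrite inE eqxx].
Qed.

Lemma vjacCt V h : vjac V h Ct = 0. Proof. by case: h. Qed.
Lemma vjacCx V h : vjac V h Cx = 0. Proof. by case: h. Qed.

Lemma smooth_vjac V h g : smooth_field V -> smooth (vjac V h g).
Proof.
move=> sV; rewrite /vjac; case: h => [||i]; [smooth_tac|smooth_tac|].
by case: g => [||j]; [smooth_tac|smooth_tac|exact: smooth_partial].
Qed.

Lemma tame_lie_corr V g w : smooth_field V -> tame w -> tame (lie_corr V g w).
Proof.
move=> sV [N wN]; rewrite (tame_lie_corrE V g wN (leqnn N)).
apply: tame_sum => i _; apply: tameZ; first exact: smooth_vjac.
by apply: tame_iprod; exists N.
Qed.

Lemma lie_corr0 V g : lie_corr V g 0 = 0.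
Proof. by rewrite (@lie_corrE 0)// big_ord0. Qed.

Lemma lie_corrD V g a b : tame a -> tame b ->
  lie_corr V g (a + b) = lie_corr V g a + lie_corr V g b.
Proof.
move=> ta tb; have [N [aN bN]] := common_tame ta tb.
rewrite (tame_lie_corrE V g aN (leqnn N)) (tame_lie_corrE V g bN (leqnn N)).
rewrite (tame_lie_corrE V g (tame_leD aN bN) (leqnn N)) -big_split.
by apply: eq_bigr => i _; rewrite iprodD fscaleDr.
Qed.

Lemma lie_corrZ V g f w : tame w -> lie_corr V g (f ** w) = f ** lie_corr V g w.
Proof.
move=> [N wN]; rewrite (tame_lie_corrE V g wN (leqnn N)).
rewrite (@lie_corrE N); last first.
  by case: wN => _ _ zw i s Ni; rewrite /fscale (zw i) ?mulr0// inE eqxx.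
rewrite fscale_sumr; apply: eq_bigr => i _.
by rewrite iprodZ -!fscaleA mulrC.
Qed.

Lemma lieV0 V : lieV V 0 = 0.
Proof.
apply/funext; elim=> [|g s IH]; first exact: vact0.
transitivity (iprod g (lieV V 0) s) => //.
by rewrite iprod_lieV iprod0 lie_corr0 addr0 IH.
Qed.

Lemma lieVD V a b : tame a -> tame b -> lieV V (a + b) = lieV V a + lieV V b.
Proof.
move=> ta tb; apply/funext => s; elim: s a b ta tb => [|g s IH] a b ta tb.
  by rewrite formDE !lieV_nil; apply: vactD; exact: tame_smooth.
transitivity (iprod g (lieV V (a + b)) s) => //.
transitivity (iprod g (lieV V a) s + iprod g (lieV V b) s) => //.
rewrite !iprod_lieV lie_corrD// !formDE iprodD (IH _ _ (tame_iprod g ta) (tame_iprod g tb)).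
by rewrite formDE addrACA.
Qed.

Lemma lieVN V a : tame a -> lieV V (- a) = - lieV V a.
Proof.
move=> ta; apply: (addrI (lieV V a)).
by rewrite -lieVD; [rewrite !subrr lieV0|tame_tac|tame_tac].
Qed.

Lemma lieV_sum V (I : Type) (r : seq I) (F : I -> dform R) : (forall i, tame (F i)) ->
  lieV V (\sum_(i <- r) F i) = \sum_(i <- r) lieV V (F i).
Proof.
move=> tF; elim: r => [|i r IH]; first by rewrite !big_nil lieV0.
by rewrite !big_cons lieVD ?IH; [|tame_tac|tame_tac].
Qed.

Lemma lieVZ V f a : smooth f -> tame a ->
  lieV V (f ** a) = vact V f ** a + f ** lieV V a.
Proof.
move=> sf ta; apply/funext => s; elim: s a ta => [|g s IH] a ta.
  by rewrite formDE !lieV_nil; exact: (vactM V sf (tame_smooth [::] ta)).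
transitivity (iprod g (lieV V (f ** a)) s) => //.
transitivity ((vact V f ** iprod g a + f ** iprod g (lieV V a)) s) => //.
rewrite !iprod_lieV lie_corrZ// iprodZ !formDE (IH _ (tame_iprod g ta)).
by rewrite !fscaleDr !formDE addrA.
Qed.

(** The new coefficients have the order of the components of [V] along the
    finitely many [theta^i] that occur in [w]. *)
Lemma tame_lieV V w : smooth_field V -> tame w -> tame (lieV V w).
Proof.
move=> sV [N wN].
have [M NM VM] := jet_order_vact N sV.
have [L [_ VL]] := bounded_orders N (fun i => sV (Cu i)).
exists (M + L).+1.
have ML : (M <= (M + L).+1)%N by rewrite leqW// leq_addr.
have LL : (L <= (M + L).+1)%N by rewrite leqW// leq_addl.
have NL := leq_trans NM ML.
have jz i h : ((M + L).+1 <= i)%N -> (h < N)%N -> vjac V (Cu h) (Cu i) = 0.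
  move=> iL hN; apply: (partial_gt_order (VL h hN)).
  by apply: leq_trans iL; rewrite ltnS leq_addl.
have jo g h : (h < N)%N -> jet_order_le (M + L).+1 (vjac V (Cu h) g).
  move=> hN; rewrite /vjac; case: g => // i; apply: jet_order_partial.
  exact: jet_orderW (VL h hN).
have E g s v : tame_le N v -> lieV V v (g :: s) =
    lieV V (iprod g v) s + \sum_(i < N) vjac V (Cu i) g * v (Cu i :: s).
  move=> vN; transitivity (iprod g (lieV V v) s) => //.
  by rewrite iprod_lieV (tame_lie_corrE V g vN (leqnn N)) formDE form_sumE.
split=> [s|s|i s Ni].
- elim: s w wN => [|g s IH] v vN.
    by rewrite lieV_nil; apply: smooth_vact => //; case: vN.
  rewrite E//; apply: smoothD; first by apply: IH; exact: tame_le_iprod.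
  apply: smooth_sum => i; apply: smoothM; first exact: smooth_vjac.
  by case: vN.
- elim: s w wN => [|g s IH] v vN.
    rewrite lieV_nil; apply: (jet_orderW ML); apply: VM.
    by case: vN.
  rewrite E//; apply: jet_orderD; first by apply: IH; exact: tame_le_iprod.
  apply: jet_order_sum => i _; apply: jet_orderM; first exact: jo.
  by apply: (jet_orderW NL); case: vN.
- elim: s w wN => [//|g s IH] v vN; rewrite inE => /predU1P[ig|us]; rewrite E//.
    rewrite -ig (_ : iprod (Cu i) v = 0); last first.
      case: vN => _ _ zv; apply/funext => r; apply: (zv i); last by rewrite inE eqxx.
      exact: leq_trans Ni.
    rewrite lieV0 add0r big1// => h _; rewrite jz ?mul0r//.
  rewrite IH//; last exact: tame_le_iprod.
  rewrite add0r big1// => h _; case: vN => _ _ zv.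
  rewrite (zv i) ?mulr0//; first exact: leq_trans Ni.
  by rewrite inE us orbT.
Qed.

Lemma vertical_lieV k V w : vertical_form k w -> vertical_form k (lieV V w).
Proof.
move=> kw s; elim: s k w kw => [|g s IH] k w kw ks.
  by rewrite lieV_nil kw// vact0.
transitivity (iprod g (lieV V w) s) => //; rewrite iprod_lieV formDE.
have -> : lie_corr V g w s = 0.
  apply: fsbig1 => h _; rewrite /vjac; case: h => [||i]; rewrite ?mul0r//.
  case: g ks => [||j] ks; rewrite ?mul0r// kw ?mulr0//.
rewrite addr0; case: k kw ks => [|k] kw ks.
  by rewrite (vertical_iprod_eq0 kw) ?orbT// lieV0.
case gv : (is_vertical g); last by rewrite (vertical_iprod_eq0 kw) ?gv// lieV0.
apply: (IH k); first exact: vertical_iprod.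
by move: ks; rewrite /= gv eqSS.
Qed.

(** The Leibniz rule. Contracting with a vector reduces it to the same rule for a
    contraction of [w]. *)
Lemma lieV_coframe_wedge V c w N : smooth_field V ->
  (forall j, (N <= j)%N -> vjac V c (Cu j) = 0) -> tame w ->
  lieV V (coframe c \wedge w) =
  \sum_(j < N) vjac V c (Cu j) ** (coframe (Cu j) \wedge w)
  + coframe c \wedge lieV V w.
Proof.
move=> sV cN tw; apply/funext => s; elim: s w tw => [|g s IH] w tw.
  rewrite formDE lieV_nil !coframe_wedge_nil vact0 addr0 form_sumE big1// => j _.
  by rewrite /fscale coframe_wedge_nil mulr0.
have [M wM] := tw.
pose L := if c is Cu i then maxn M i.+1 else M.
have ML : (M <= L)%N by rewrite /L; case: c {L cN IH} => // i; exact: leq_maxl.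
have cL i : c = Cu i -> (i < L)%N.
  by rewrite /L => ->; exact: leq_maxr.
have wL := tame_leW ML wM.
have cwL := tame_le_coframe_wedge cL wL.
have tg := tame_iprod g tw.
have J : lie_corr V g (coframe c \wedge w) =
    vjac V c g ** w - coframe c \wedge lie_corr V g w.
  rewrite (tame_lie_corrE V g cwL (leqnn L)) (tame_lie_corrE V g wL (leqnn L)).
  under eq_bigr => i _ do rewrite iprod_coframe_wedge fscaleDr fscaleN -wedgeZr.
  rewrite sumrB wedge_sumr; congr (_ - _).
  case cE : c => [||k].
  - by rewrite big1 ?fscale0l// => i _; rewrite fscale0r.
  - by rewrite big1 ?fscale0l// => i _; rewrite fscale0r.
  rewrite (bigD1 (Ordinal (cL k cE)))//= eqxx big1 ?addr0// => i ik.
  rewrite (_ : (Cu i == Cu k) = false) ?fscale0r//.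
  by apply: contraNF ik => /eqP[e]; apply/eqP/val_inj.
have K : \sum_(j < N) vjac V c (Cu j) ** (if g == Cu j then w else 0)
       = vjac V c g ** w.
  case gE : g => [||k].
  - by rewrite vjacCt fscale0l big1// => j _; rewrite fscale0r.
  - by rewrite vjacCx fscale0l big1// => j _; rewrite fscale0r.
  have [kN|Nk] := ltnP k N.
    rewrite (bigD1 (Ordinal kN))//= eqxx big1 ?addr0// => i ik.
    rewrite (_ : (Cu k == Cu i) = false) ?fscale0r//.
    by apply: contraNF ik => /eqP[e]; apply/eqP/val_inj.
  rewrite cN// fscale0l big1// => i _.
  rewrite (_ : (Cu k == Cu i) = false) ?fscale0r//.
  by apply/eqP => -[e]; move: Nk; rewrite e leqNgt ltn_ord.
transitivity (iprod g (lieV V (coframe c \wedge w)) s) => //.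
transitivity ((\sum_(j < N) vjac V c (Cu j) ** iprod g (coframe (Cu j) \wedge w)
   + iprod g (coframe c \wedge lieV V w)) s).
  rewrite iprod_lieV J iprod_coframe_wedge lieVD; [|tame_tac|tame_tac].
  rewrite lieVN; last by tame_tac.
  rewrite iprod_coframe_wedge iprod_lieV wedgeDr opprD.
  under eq_bigr => j _ do rewrite iprod_coframe_wedge fscaleDr fscaleN.
  rewrite sumrB K !(formDE, formNE) (IH _ tg) formDE.
  have -> : lieV V (if g == c then w else 0) = if g == c then lieV V w else 0.
    by case: ifP => _ //; rewrite lieV0.
  move: ((if _ then _ else _) s) ((\sum_(_ < _) _) s) ((_ \wedge lieV V _) s).
  move: ((_ ** w) s) ((_ \wedge lie_corr V g w) s) => *; ring.
by rewrite !formDE !form_sumE.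
Qed.

End LieDerivative.

Ltac smooth_hook ::= lazymatch goal with
  | |- smooth (iter _ Dx _) => apply: smooth_iterDx; smooth_tac
  | |- smooth (Dx _) => apply: smooth_Dx; smooth_tac
  | |- smooth (vjac _ _ _) => apply: smooth_vjac; smooth_tac
  | |- smooth (vact _ _) => apply: smooth_vact; smooth_tac
  | |- smooth_field total_x => exact: smooth_total_x
  | |- smooth_field (evol _) => apply: smooth_evol; smooth_tac
  end.

Ltac tame_hook ::= lazymatch goal with
  | |- tame (lieV _ _) => apply: tame_lieV; [smooth_tac|tame_tac]
  | |- tame (lie_corr _ _ _) => apply: tame_lie_corr; [smooth_tac|tame_tac]
  end.

(** * The vertical differential *)

Section VerticalDifferential.
Context {R : realType}.
Implicit Types (f : fn R) (V W : vfield R) (a b w : dform R) (c d g : jcoord).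

(** The product of [d_V f] with [w]. *)
Definition grad_wedge f w : dform R :=
  \sum_(j \in [set: nat]) partial (Cu j) f ** (theta j \wedge w).

Lemma grad_wedgeE N M f w : jet_order_le N f -> (N < M)%N ->
  grad_wedge f w = \sum_(j < M) partial (Cu j) f ** (theta j \wedge w).
Proof.
move=> fN NM; apply: fsum_nat => j Mj.
by rewrite (partial_gt_order fN (leq_trans NM Mj)) fscale0l.
Qed.

Lemma dVEE N M w : tame_le N w -> (N < M)%N ->
  dVE w = \sum_(j < M) (theta j \wedge cpartial (Cu j) w).
Proof.
move=> [_ wN _] NM; apply: fsum_nat => j Mj.
rewrite (_ : (fun s => _) = 0) ?wedge0r//; apply/funext => s.
exact: (partial_gt_order (wN s) (leq_trans NM Mj)).
Qed.

Lemma sum_iprod_theta M g (F : nat -> dform R) : (forall i, (M <= i)%N -> F i = 0) ->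
  \sum_(j < M) (if g == Cu j then F j else 0) =
  (if g is Cu k then F k else 0).
Proof.
move=> F0; case: g => [||k]; try by rewrite big1.
have [kM|Mk] := ltnP k M.
  rewrite (bigD1 (Ordinal kM))//= eqxx big1 ?addr0// => i ik.
  rewrite (_ : (Cu k == Cu i) = false)//.
  by apply: contraNF ik => /eqP[e]; apply/eqP/val_inj.
rewrite F0// big1// => i _.
rewrite (_ : (Cu k == Cu i) = false)//.
by apply/eqP => -[e]; move: Mk; rewrite e leqNgt ltn_ord.
Qed.

Lemma iprod_grad_wedge g f w : smooth f ->
  iprod g (grad_wedge f w) =
  (if g is Cu k then partial (Cu k) f ** w else 0) - grad_wedge f (iprod g w).
Proof.
move=> sf; have [N fN] := smooth_order sf.
rewrite !(grad_wedgeE _ fN (ltnSn N)) iprod_sum.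
under eq_bigr => j _ do rewrite iprodZ iprod_coframe_wedge fscaleDr fscaleN.
rewrite sumrB; congr (_ - _).
rewrite -(@sum_iprod_theta N.+1 g (fun j => partial (Cu j) f ** w)).
  by apply: eq_bigr => j _; case: ifP => _ //; rewrite fscale0r.
by move=> i Ni; rewrite (partial_gt_order fN Ni) fscale0l.
Qed.

Lemma iprod_dVE g w : tame w ->
  iprod g (dVE w) = (if is_vertical g then cpartial g w else 0) - dVE (iprod g w).
Proof.
move=> [N wN].
rewrite (dVEE wN (ltnSn N)) (dVEE (tame_le_iprod g wN) (ltnSn N)) iprod_sum.
under eq_bigr => j _ do rewrite iprod_coframe_wedge.
rewrite sumrB; congr (_ - _).
rewrite (@sum_iprod_theta N.+1 g (fun j => cpartial (Cu j) w)); first by case: g.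
move=> i Ni; apply/funext => s; case: wN => _ wN _.
exact: (partial_gt_order (wN s) Ni).
Qed.

Lemma dVE_nil w : tame w -> dVE w [::] = 0.
Proof.
move=> [N wN]; rewrite (dVEE wN (ltnSn N)) form_sumE big1// => j _.
exact: coframe_wedge_nil.
Qed.

Lemma grad_wedgeN f w : smooth f -> grad_wedge f (- w) = - grad_wedge f w.
Proof.
move=> sf; have [N fN] := smooth_order sf; rewrite !(grad_wedgeE _ fN (ltnSn N)) -sumrN.
by apply: eq_bigr => j _; rewrite wedgeNr fscaleN.
Qed.

Lemma grad_wedge0 w : grad_wedge 0 w = 0.
Proof. by apply: fsbig1 => j _; rewrite partial0 fscale0l. Qed.

Lemma tame_dVE w : tame w -> tame (dVE w).
Proof.
move=> tw; have [N wN] := tw; rewrite (dVEE wN (ltnSn N)).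
by tame_tac.
Qed.

Lemma cpartialD c a b : tame a -> tame b -> cpartial c (a + b) = cpartial c a + cpartial c b.
Proof.
move=> ta tb; apply/funext => s.
exact: (smooth_partialD c (tame_smooth s ta) (tame_smooth s tb)).
Qed.

Lemma cpartialN c a : tame a -> cpartial c (- a) = - cpartial c a.
Proof. by move=> ta; apply/funext => s; exact: (smooth_partialN c (tame_smooth s ta)). Qed.

Lemma cpartial0 c : cpartial c (0 : dform R) = 0.
Proof. by apply/funext => s; exact: partial0. Qed.

Lemma cpartialZ c f a : smooth f -> tame a ->
  cpartial c (f ** a) = partial c f ** a + f ** cpartial c a.
Proof.
by move=> sf ta; apply/funext => s; exact: (smooth_partialM c sf (tame_smooth s ta)).
Qed.

Lemma iprod_cpartial c g w : iprod g (cpartial c w) = cpartial c (iprod g w).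
Proof. by []. Qed.

Lemma cpartial_sum c (I : Type) (r : seq I) (F : I -> dform R) : (forall i, tame (F i)) ->
  cpartial c (\sum_(i <- r) F i) = \sum_(i <- r) cpartial c (F i).
Proof.
move=> tF; elim: r => [|i r IH]; first by rewrite !big_nil cpartial0.
by rewrite !big_cons cpartialD ?IH; [|tame_tac|tame_tac].
Qed.

Lemma dVED a b : tame a -> tame b -> dVE (a + b) = dVE a + dVE b.
Proof.
move=> ta tb; have [N [aN bN]] := common_tame ta tb.
rewrite (dVEE aN (ltnSn N)) (dVEE bN (ltnSn N)) (dVEE (tame_leD aN bN) (ltnSn N)).
by rewrite -big_split; apply: eq_bigr => j _; rewrite cpartialD ?wedgeDr.
Qed.

Lemma dVE0 : dVE (0 : dform R) = 0.
Proof.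
by rewrite (dVEE (tame_le0 0) (ltnSn 0)) big1// => j _; rewrite cpartial0 wedge0r.
Qed.

Lemma dVE_sum (I : Type) (r : seq I) (F : I -> dform R) : (forall i, tame (F i)) ->
  dVE (\sum_(i <- r) F i) = \sum_(i <- r) dVE (F i).
Proof.
move=> tF; elim: r => [|i r IH]; first by rewrite !big_nil dVE0.
by rewrite !big_cons dVED ?IH; [|tame_tac|tame_tac].
Qed.

Lemma dVEZ f a : smooth f -> tame a -> dVE (f ** a) = grad_wedge f a + f ** dVE a.
Proof.
move=> sf ta; have [N aN] := ta; have [M fM] := smooth_order sf.
have NL := leq_maxl N M; have ML := leq_maxr N M.
have aL := tame_leW NL aN; have fL := jet_orderW ML fM.
rewrite (dVEE (tame_leZ sf fL aL) (ltnSn _)) (dVEE aL (ltnSn _)) (grad_wedgeE _ fL (ltnSn _)).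
rewrite fscale_sumr -big_split; apply: eq_bigr => j _.
by rewrite cpartialZ// wedgeDr !wedgeZr.
Qed.

Lemma cpartial_coframe_wedge c d w : tame w ->
  cpartial c (coframe d \wedge w) = coframe d \wedge cpartial c w.
Proof.
move=> tw; apply/funext => s; elim: s w tw => [|g s IH] w tw.
  by rewrite /cpartial !coframe_wedge_nil partial0.
transitivity (cpartial c (iprod g (coframe d \wedge w)) s) => //.
transitivity (iprod g (coframe d \wedge cpartial c w) s) => //.
have tg := tame_iprod g tw.
rewrite !iprod_coframe_wedge cpartialD; [|tame_tac|tame_tac]; rewrite cpartialN; last by tame_tac.
rewrite !(formDE, formNE) (IH _ tg); congr (_ - _).
by case: ifP => _ //; rewrite cpartial0.
Qed.

Lemma dVE_coframe_wedge c w : tame w -> dVE (coframe c \wedge w) = - (coframe c \wedge dVE w).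
Proof.
move=> tw; have [N wN] := tw; have [M cwM] := tame_coframe_wedge c tw.
have NL : (N < (N + M).+1)%N by rewrite ltnS leq_addr.
have ML : (M < (N + M).+1)%N by rewrite ltnS leq_addl.
rewrite (dVEE cwM ML) (dVEE wN NL) wedge_sumr -sumrN; apply: eq_bigr => j _.
by rewrite cpartial_coframe_wedge// coframe_wedgeC.
Qed.

Lemma vertical_dVE k w : tame w -> vertical_form k w -> vertical_form k.+1 (dVE w).
Proof.
move=> [N wN] kw; rewrite (dVEE wN (ltnSn N)); apply: vertical_form_sum => j.
apply: vertical_coframe_wedge => s ks; rewrite /cpartial kw ?partial0//.
Qed.

(** Only the components of [V] along the [d/du_h] depend on [u_k]. *)
Lemma partial_vact_contact V f k N : contact_field V -> smooth f -> jet_order_le N f ->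
  partial (Cu k) (vact V f) = vact V (partial (Cu k) f)
  + \sum_(h < N.+1) vjac V (Cu h) (Cu k) * partial (Cu h) f.
Proof.
move=> [sV cV] sf fN; rewrite (partial_vact (Cu k) sV sf); congr (_ + _).
rewrite (vactE _ fN) sum_coords !cV//.
by rewrite !mul0r !add0r.
Qed.

(** The bracket of [d/du_k] with [V] acts on the coefficients through its
    components [dV^h/du_k], and on the [theta^h] through the differentials of
    these components. *)
Lemma cpartial_lieV V k w N : contact_field V -> tame_le N w -> skew_form w ->
  cpartial (Cu k) (lieV V w) = lieV V (cpartial (Cu k) w)
  + \sum_(h < N.+1) vjac V (Cu h) (Cu k) ** cpartial (Cu h) w
  + \sum_(h < N.+1) grad_wedge (vjac V (Cu h) (Cu k)) (iprod (Cu h) w).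
Proof.
move=> cV; have sV := cV.1.
have sj h : smooth (vjac V h (Cu k)) by exact: smooth_vjac.
move=> wN aw; apply/funext => s; elim: s w wN aw => [|g s IH] w wN aw.
  rewrite !formDE !form_sumE [X in _ + X]big1 ?addr0; last first.
    move=> h _; have [L jL] := smooth_order (sj (Cu h)).
    rewrite (grad_wedgeE _ jL (ltnSn L)) form_sumE big1// => j _.
    by rewrite /fscale coframe_wedge_nil mulr0.
  have [sw ow _] := wN.
  exact: (partial_vact_contact k cV (sw [::]) (ow [::])).
have tw : tame w by exists N.
have tg := tame_iprod g tw.
transitivity (cpartial (Cu k) (iprod g (lieV V w)) s) => //.
transitivity ((iprod g (lieV V (cpartial (Cu k) w))
  + \sum_(h < N.+1) vjac V (Cu h) (Cu k) ** cpartial (Cu h) (iprod g w)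
  + \sum_(h < N.+1) iprod g (grad_wedge (vjac V (Cu h) (Cu k)) (iprod (Cu h) w))) s);
  last by rewrite !formDE !form_sumE.
rewrite !iprod_lieV cpartialD; [|exact: tame_lieV|exact: tame_lie_corr].
rewrite (tame_lie_corrE V g wN (leqnSn N)).
rewrite (tame_lie_corrE V g (tame_le_cpartial (Cu k) wN) (leqnSn N)).
rewrite cpartial_sum; last first.
  by move=> h; apply: tameZ; [exact: smooth_vjac|tame_tac].
under [X in cpartial _ (lieV V _) + X]eq_bigr => h _.
  rewrite cpartialZ; [|exact: smooth_vjac|tame_tac].
  over.
rewrite sum_formD.
under [X in _ = (_ + X) s]eq_bigr => h _.
  rewrite iprod_grad_wedge// (iprod_iprod _ _ aw) grad_wedgeN// opprK.
  over.
rewrite sum_formD.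
(* symmetry of the second derivatives of the components of V *)
have -> : \sum_(h < N.+1) partial (Cu k) (vjac V (Cu h) g) ** iprod (Cu h) w =
    \sum_(h < N.+1) (if g is Cu j
      then partial (Cu j) (vjac V (Cu h) (Cu k)) ** iprod (Cu h) w else 0).
  apply: eq_bigr => h _; case: (g) => [||j].
  - by rewrite vjacCt partial0 fscale0l.
  - by rewrite vjacCx partial0 fscale0l.
  by rewrite /vjac (partialC _ _ (sV _)).
move: (IH _ (tame_le_iprod g wN) (skew_form_iprod g aw)).
rewrite !formDE => ->; rewrite !iprod_cpartial.
move: (\sum_(_ < _) _) => S1.
move: (lieV V _ s) (S1 s) ((\sum_(_ < _) _) s) ((\sum_(_ < _) _) s) ((\sum_(_ < _) _) s) => *.
ring.
Qed.

(** Contraction with [d/du_k] turns the claim into the one for the contraction,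
    plus two copies of the action of the bracket of [d/du_k] with [V]: one from
    [cpartial_lieV], one from contracting the derivation along [V]. They
    cancel. *)
Lemma dVE_lieV V w : contact_field V -> tame w -> skew_form w ->
  dVE (lieV V w) = lieV V (dVE w).
Proof.
move=> cV tw aw; have sV := cV.1.
apply/funext => s; elim: s w tw aw => [|g s IH] w tw aw.
  rewrite lieV_nil !dVE_nil ?vact0//; exact: tame_lieV.
have tg := tame_iprod g tw; have ag := skew_form_iprod g aw.
have tLg := tame_lieV sV tg.
transitivity (iprod g (dVE (lieV V w)) s) => //.
transitivity (iprod g (lieV V (dVE w)) s) => //.
rewrite iprod_lieV !iprod_dVE//; last exact: tame_lieV.
rewrite iprod_lieV dVED//; last exact: tame_lie_corr.
rewrite lieVD; [|case: ifP => _; tame_tac|by apply/tameN/tame_dVE].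
rewrite lieVN; last exact: tame_dVE.
have [N wN] := tw.
have [M dM] := tame_dVE tw.
have wL := tame_leW (leq_addr M N) wN.
have dL := tame_leW (leq_addl N M) dM.
rewrite (tame_lie_corrE V g wL (leqnSn _)) (tame_lie_corrE V g dL (leqnSn _)).
rewrite dVE_sum; last by move=> h; apply: tameZ; [exact: smooth_vjac|tame_tac].
under eq_bigr => h _.
  rewrite dVEZ; [|smooth_tac|tame_tac].
  over.
under [X in _ = (_ + X) s]eq_bigr => h _ do rewrite iprod_dVE// fscaleDr fscaleN.
rewrite sumrB sum_formD.
have -> : (if is_vertical g then cpartial g (lieV V w) else 0) =
    lieV V (if is_vertical g then cpartial g w else 0)
    + \sum_(h < (N + M).+1) vjac V (Cu h) g ** cpartial (Cu h) w
    + \sum_(h < (N + M).+1) grad_wedge (vjac V (Cu h) g) (iprod (Cu h) w).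
  case: (g) => [||k]; last exact: cpartial_lieV.
  - by rewrite !big1 ?lieV0 ?addr0// => h _; rewrite vjacCt ?fscale0l ?grad_wedge0.
  - by rewrite !big1 ?lieV0 ?addr0// => h _; rewrite vjacCx ?fscale0l ?grad_wedge0.
rewrite !(formDE, formNE) (IH _ tg ag).
move: (lieV V _ s) (lieV V (dVE _) s).
move: ((\sum_(_ < _) _) s) ((\sum_(_ < _) _) s) ((\sum_(_ < _) _) s) => *.
ring.
Qed.

(** After contraction the only terms that are not visibly symmetric in [V] and [W]
    assemble into the derivatives of the [V (W^h)]. *)
Lemma lieV_comm V W w : contact_field V -> contact_field W ->
  (forall c, vact V (W c) = vact W (V c)) -> tame w ->
  lieV V (lieV W w) = lieV W (lieV V w).
Proof.
move=> cV cW VW tw; have sV := cV.1; have sW := cW.1.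
apply/funext => s; elim: s w tw => [|g s IH] w tw.
  exact: (vact_comm sV sW (tame_smooth [::] tw) VW).
have tg := tame_iprod g tw.
have [N wN] := tw.
(* The last sum is symmetric in the two fields by assumption, the two middle
   ones are exchanged; M exceeds the order of the components involved. *)
have H A B : contact_field A -> contact_field B -> exists L, forall M, (L <= M)%N ->
    iprod g (lieV A (lieV B w)) = lieV A (lieV B (iprod g w))
    + \sum_(h < M) vjac B (Cu h) g ** lieV A (iprod (Cu h) w)
    + \sum_(h < M) vjac A (Cu h) g ** lieV B (iprod (Cu h) w)
    + \sum_(h < N) (if g is Cu k then partial (Cu k) (vact A (B (Cu h))) else 0)
        ** iprod (Cu h) w.
  move=> cA cB; have sA := cA.1; have sB := cB.1.
  have [P BwP] := tame_lieV sB tw.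
  have [Q [_ BQ]] := bounded_orders N (fun i => sB (Cu i)).
  exists (N + P + Q.+1)%N => M LM.
  have NM : (N <= M)%N by apply: leq_trans LM; rewrite -addnA leq_addr.
  have PM : (P <= M)%N by apply: leq_trans LM; rewrite addnAC leq_addl.
  have QM : (Q < M)%N by apply: leq_trans LM; rewrite leq_addl.
  rewrite iprod_lieV (tame_lie_corrE A g BwP PM).
  rewrite iprod_lieV lieVD; [|tame_tac|tame_tac].
  rewrite {1}(tame_lie_corrE B g wN NM).
  rewrite lieV_sum; last by tame_tac.
  under eq_bigr => h _.
    rewrite lieVZ; [|smooth_tac|tame_tac].
    over.
  under [X in _ + _ + X]eq_bigr => k _.
    rewrite iprod_lieV fscaleDr (tame_lie_corrE B (Cu k) wN (leqnn N)) fscale_sumr.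
    over.
  rewrite !sum_formD.
  have -> : \sum_(h < M) vact A (vjac B (Cu h) g) ** iprod (Cu h) w =
            \sum_(h < N) vact A (vjac B (Cu h) g) ** iprod (Cu h) w.
    rewrite (big_ord_widen _ (fun h => vact A (vjac B (Cu h) g) ** iprod (Cu h) w) NM).
    rewrite [RHS]big_mkcond; apply: eq_bigr => h _.
    case: ltnP => // Nh.
    have -> : iprod (Cu h) w = 0; last by rewrite fscale0r.
    by case: wN => _ _ zw; apply/funext => r; apply: (zw h) => //; rewrite inE eqxx.
  have core : \sum_(h < N) vact A (vjac B (Cu h) g) ** iprod (Cu h) w
     + \sum_(k < M) \sum_(h < N)
         vjac A (Cu k) g ** (vjac B (Cu h) (Cu k) ** iprod (Cu h) w)
     = \sum_(h < N) (if g is Cu k then partial (Cu k) (vact A (B (Cu h))) else 0)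
        ** iprod (Cu h) w.
    rewrite [X in _ + X]exchange_big -sum_formD; apply: eq_bigr => h _.
    under eq_bigr => k _ do rewrite -fscaleA.
    rewrite -fscale_suml -fscaleDl; congr (_ ** _).
    case: (g) => [||k].
    - by rewrite vjacCt vact0 add0r big1// => j _; rewrite vjacCt mul0r.
    - by rewrite vjacCx vact0 add0r big1// => j _; rewrite vjacCx mul0r.
    case: (M) QM => [//|M']; rewrite ltnS => QM'.
    by rewrite (partial_vact_contact k cA (sB _) (jet_orderW QM' (BQ h (ltn_ord h)))).
  rewrite -core; apply/funext => r; rewrite !formDE.
  move: (lieV _ _ r) => a0.
  move: ((\sum_(_ < N) _) r) ((\sum_(_ < M) _) r) ((\sum_(_ < M) _) r) ((\sum_(_ < M) _) r) => *.
  ring.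
have [L1 H1] := H V W cV cW; have [L2 H2] := H W V cW cV.
transitivity (iprod g (lieV V (lieV W w)) s) => //.
transitivity (iprod g (lieV W (lieV V w)) s) => //.
rewrite (H1 _ (leq_addr L2 L1)) (H2 _ (leq_addl L1 L2)).
under [X in (_ + X) s = _]eq_bigr => h _ do rewrite VW.
rewrite [X in (X + _) s = _]addrAC !formDE (IH _ tg).
exact: erefl.
Qed.

End VerticalDifferential.

(** * The Euler operator and adjoints of linearizations *)

Section Euler.
Context {R : realType}.
Implicit Types (f K : fn R) (V W : vfield R) (a b w v : dform R) (c d g : jcoord).

Lemma sum_form_recr (F : nat -> dform R) n :
  \sum_(i < n.+1) F i = \sum_(i < n) F i + F n.
Proof. exact: big_ord_recr. Qed.

Lemma sum_form_recl (F : nat -> dform R) n :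
  \sum_(i < n.+1) F i = F 0%N + \sum_(i < n) F i.+1.
Proof. exact: big_ord_recl. Qed.

Definition negX v : dform R := - lieV total_x v.

Lemma contact_total_x : contact_field (@total_x R).
Proof.
split; first exact: smooth_total_x.
by case=> // d _ /=; rewrite ?partial0 ?partial1.
Qed.

Lemma contact_evol K : smooth K -> contact_field (evol K).
Proof.
move=> sK; split; first exact: smooth_evol.
by case=> // d _; rewrite ?evolCt ?evolCx ?partial0 ?partial1.
Qed.

(** Hence [T] and [X] commute, by [lieV_comm]. *)
Lemma evol_total_x K c : smooth K -> vact (evol K) (total_x c) = Dx (evol K c).
Proof.
move=> sK; case: c => [||i] /=.
- by rewrite evolCt vact0 /Dx vact1.
- by rewrite evolCx vact1 /Dx vact0.
by rewrite vact_u !evolCu.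
Qed.

Lemma tame_negX v : tame v -> tame (negX v).
Proof. by move=> tv; rewrite /negX; tame_tac. Qed.

Lemma tame_iter_negX i v : tame v -> tame (iter i negX v).
Proof. by move=> tv; elim: i => //= i; exact: tame_negX. Qed.

Lemma negXD a b : tame a -> tame b -> negX (a + b) = negX a + negX b.
Proof. by move=> ta tb; rewrite /negX lieVD// opprD. Qed.

Lemma negX0 : negX (0 : dform R) = 0.
Proof. by rewrite /negX lieV0 oppr0. Qed.

Lemma negXN a : tame a -> negX (- a) = - negX a.
Proof. by move=> ta; rewrite /negX lieVN. Qed.

Lemma iter_negX0 i : iter i negX (0 : dform R) = 0.
Proof. by elim: i => //= i ->; rewrite negX0. Qed.

Lemma iter_negXD i a b : tame a -> tame b ->
  iter i negX (a + b) = iter i negX a + iter i negX b.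
Proof.
move=> ta tb; elim: i => //= i ->; rewrite negXD//; exact: tame_iter_negX.
Qed.

Lemma iter_negXN i a : tame a -> iter i negX (- a) = - iter i negX a.
Proof.
move=> ta; elim: i => //= i ->; rewrite negXN//; exact: tame_iter_negX.
Qed.

Lemma iter_negX_sum i (I : Type) (r : seq I) (F : I -> dform R) : (forall j, tame (F j)) ->
  iter i negX (\sum_(j <- r) F j) = \sum_(j <- r) iter i negX (F j).
Proof.
move=> tF; elim: r => [|j r IH]; first by rewrite !big_nil iter_negX0.
by rewrite !big_cons iter_negXD ?IH; [|tame_tac|tame_tac].
Qed.

Lemma vertical_iter_negX k i v : vertical_form k v -> vertical_form k (iter i negX v).
Proof. by move=> kv; elim: i => //= i kw; apply/vertical_formN/vertical_lieV. Qed.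

Lemma evol_negX K v : smooth K -> tame v ->
  lieV (evol K) (negX v) = negX (lieV (evol K) v).
Proof.
move=> sK tv; rewrite /negX lieVN; last by tame_tac.
rewrite (lieV_comm (contact_evol sK) contact_total_x)//.
by move=> c; rewrite evol_total_x.
Qed.

Lemma evol_iter_negX K i v : smooth K -> tame v ->
  lieV (evol K) (iter i negX v) = iter i negX (lieV (evol K) v).
Proof.
move=> sK tv; elim: i => //= i <-; rewrite evol_negX//; exact: tame_iter_negX.
Qed.

(** The interior Euler operator, of which [IE] is a normalized product with
    [theta^0]. *)
Definition euler w : dform R :=
  \sum_(i \in [set: nat]) iter i negX (iprod (Cu i) w).

(** The formal adjoint of [sum_i (df/du_i) X^i], applied to [v]. *)
Definition lin_adjoint f v : dform R :=
  \sum_(i \in [set: nat]) iter i negX (partial (Cu i) f ** v).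

Lemma eulerE N M w : tame_le N w -> (N <= M)%N ->
  euler w = \sum_(i < M) iter i negX (iprod (Cu i) w).
Proof.
move=> [_ _ zw] NM; apply: fsum_nat => i Mi.
rewrite (_ : iprod _ _ = 0) ?iter_negX0//; apply/funext => s.
by apply: (zw i); [exact: leq_trans Mi|rewrite inE eqxx].
Qed.

Lemma lin_adjointE N M f v : jet_order_le N f -> (N < M)%N ->
  lin_adjoint f v = \sum_(i < M) iter i negX (partial (Cu i) f ** v).
Proof.
move=> fN NM; apply: fsum_nat => i Mi.
by rewrite (partial_gt_order fN (leq_trans NM Mi)) fscale0l iter_negX0.
Qed.

Lemma tame_euler w : tame w -> tame (euler w).
Proof.
move=> tw; have [N wN] := tw; rewrite (eulerE wN (leqnn N)).
by apply: tame_sum => i _; apply: tame_iter_negX; tame_tac.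
Qed.

Lemma eulerN w : tame w -> euler (- w) = - euler w.
Proof.
move=> tw; have [N wN] := tw.
rewrite (eulerE wN (leqnn N)) (eulerE (tame_leN wN) (leqnn N)) -sumrN.
by apply: eq_bigr => i _; rewrite iprodN iter_negXN//; tame_tac.
Qed.

Lemma lin_adjointD f a b : smooth f -> tame a -> tame b ->
  lin_adjoint f (a + b) = lin_adjoint f a + lin_adjoint f b.
Proof.
move=> sf ta tb; have [N fN] := smooth_order sf; rewrite !(lin_adjointE _ fN (ltnSn N)).
by rewrite -sum_formD; apply: eq_bigr => i _; rewrite fscaleDr iter_negXD//; tame_tac.
Qed.

Lemma lin_adjoint0 f : lin_adjoint f 0 = 0.
Proof. by apply: fsbig1 => i _; rewrite fscale0r iter_negX0. Qed.

Lemma lin_adjoint_sum f (I : Type) (r : seq I) (F : I -> dform R) : smooth f ->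
  (forall j, tame (F j)) ->
  lin_adjoint f (\sum_(j <- r) F j) = \sum_(j <- r) lin_adjoint f (F j).
Proof.
move=> sf tF; elim: r => [|j r IH]; first by rewrite !big_nil lin_adjoint0.
by rewrite !big_cons lin_adjointD ?IH//; tame_tac.
Qed.

Lemma vertical_euler k w : tame w -> vertical_form k.+1 w -> vertical_form k (euler w).
Proof.
move=> [N wN] kw; rewrite (eulerE wN (leqnn N)); apply: vertical_form_sum => i.
exact/vertical_iter_negX/vertical_iprod.
Qed.

(** The linearization of [Dx f] is [X] composed with that of [f]. On adjoints this
    is an Abel summation based on [partial_Dx]. *)
Lemma lin_adjoint_Dx f v : smooth f -> tame v ->
  lin_adjoint (Dx f) v = lin_adjoint f (negX v).
Proof.
move=> sf tv; have [N fN] := smooth_order sf; have [M DM] := smooth_order (smooth_Dx sf).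
have NL : (N < (N + M).+1)%N by rewrite ltnS leq_addr.
have ML : (M < (N + M).+2)%N by rewrite ltnS leqW// leq_addl.
rewrite (lin_adjointE v DM ML) (lin_adjointE (negX v) fN NL).
have E i : iter i negX (partial (Cu i) (Dx f) ** v) =
    iter i negX (Dx (partial (Cu i) f) ** v) +
    (if i is j.+1 then iter i negX (partial (Cu j) f ** v) else 0).
  rewrite (partial_Dx (Cu i) sf) fscaleDl iter_negXD; [|tame_tac|case: i => [|i]].
  - by case: i => [|i] //; rewrite fscale0l.
  - by rewrite fscale0l; tame_tac.
  - by tame_tac.
under eq_bigr => i _ do rewrite E.
rewrite sum_formD.
rewrite (sum_form_recr (fun i => iter i negX (Dx (partial (Cu i) f) ** v))).
rewrite (partial_gt_order fN NL) {2}/Dx vact0 fscale0l iter_negX0 addr0.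
rewrite (sum_form_recl
  (fun i => if i is j.+1 then iter i negX (partial (Cu j) f ** v) else 0)).
rewrite add0r -sum_formD.
apply: eq_bigr => i _.
rewrite iterSr -iter_negXD; [|tame_tac|by apply: tame_negX; tame_tac].
congr (iter _ _ _); rewrite /negX fscaleN lieVZ; [|smooth_tac|tame_tac].
by rewrite opprD addrA addrN add0r.
Qed.

Lemma lin_adjoint_iterDx h f v : smooth f -> tame v ->
  lin_adjoint (iter h Dx f) v = lin_adjoint f (iter h negX v).
Proof.
move=> sf; elim: h v => [//|h IH] v tv.
rewrite iterS (lin_adjoint_Dx (smooth_iterDx h sf) tv) iterSr.
exact: (IH _ (tame_negX tv)).
Qed.

(** Contraction with [d/du_i] and [T] commute up to the [d(D_x^h K)/du_i]. Summed
    over [i] these give the adjoint of the linearization of [D_x^h K], which is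
    [L_K^*] composed with [(-X)^h]. *)
Lemma euler_evol K w : smooth K -> tame w ->
  euler (lieV (evol K) w) = lieV (evol K) (euler w) + lin_adjoint K (euler w).
Proof.
move=> sK tw; have [N wN] := tw; have sE := smooth_evol sK.
have [P TP] := tame_lieV sE tw.
have [Q [_ KQ]] := bounded_orders N (fun i => smooth_iterDx i sK).
pose M := (N + P + Q.+1)%N.
have NM : (N <= M)%N by rewrite /M -addnA leq_addr.
have PM : (P <= M)%N by rewrite /M addnAC leq_addl.
have QM : (Q < M)%N by rewrite /M leq_addl.
rewrite (eulerE TP PM) {1}(eulerE wN NM) {1}(eulerE wN (leqnn N)).
rewrite lieV_sum; last by move=> i; apply: tame_iter_negX; tame_tac.
rewrite lin_adjoint_sum//; last by move=> i; apply: tame_iter_negX; tame_tac.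
under eq_bigr => i _.
  rewrite iprod_lieV iter_negXD; [|tame_tac|tame_tac].
  rewrite -evol_iter_negX//; last by tame_tac.
  over.
rewrite sum_formD; congr (_ + _).
under eq_bigr => i _.
  rewrite (tame_lie_corrE _ _ wN (leqnn N)) iter_negX_sum; last by tame_tac.
  over.
rewrite exchange_big; apply: eq_bigr => h _.
rewrite -lin_adjoint_iterDx//; last by tame_tac.
rewrite (lin_adjointE _ (KQ h (ltn_ord h)) QM); apply: eq_bigr => i _.
by rewrite /vjac evolCu.
Qed.

Lemma vjac_total_x h g :
  vjac total_x h g = (if (h, g) is (Cu i, Cu j.+1) then (i == j)%:R else 0) :> fn R.
Proof.
rewrite /vjac; case: h => [||i]; [by []|by []|]; case: g => [||j]; [by []|by []|].
rewrite /= partial_u; case: j => [|j]; first by [].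
suff -> : (Cu j.+1 == Cu i.+1) = (i == j) by [].
by apply/eqP/eqP => [[]|->].
Qed.

Lemma lie_corr_total_x g w : tame w ->
  lie_corr total_x g w = (if g is Cu i.+1 then iprod (Cu i) w else 0).
Proof.
move=> [N wN]; rewrite (tame_lie_corrE _ _ wN (leqnn N)).
under eq_bigr => i _ do rewrite vjac_total_x.
case: g => [||[|k]]; try by rewrite big1// => i _; rewrite fscale0l.
have [kN|Nk] := ltnP k N.
  rewrite (bigD1 (Ordinal kN))//= eqxx fscale1 big1 ?addr0// => i ik.
  rewrite (_ : (i == k :> nat) = false) ?fscale0l//.
  by apply: contraNF ik => /eqP e; apply/eqP/val_inj.
rewrite big1 => [|i _].
  case: wN => _ _ zw; apply/funext => s; apply/esym/(zw k) => //.
  by rewrite inE eqxx.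
rewrite (_ : (i == k :> nat) = false) ?fscale0l//.
by apply/eqP => e; move: Nk; rewrite -e leqNgt ltn_ord.
Qed.

(** As contraction with [d/du_(i+1)] and [X] commute up to contraction with
    [d/du_i], the sum telescopes. *)
Lemma euler_total_x w : tame w -> euler (lieV total_x w) = 0.
Proof.
move=> tw; have [N wN] := tw.
have [P XP] := tame_lieV (@smooth_total_x R) tw.
have NM : (N <= (N + P).+1)%N by rewrite leqW// leq_addr.
have PM : (P <= (N + P).+1)%N by rewrite leqW// leq_addl.
rewrite (eulerE XP PM).
have E i : iter i negX (iprod (Cu i) (lieV total_x w)) =
   (if i is j.+1 then iter j.+1 negX (iprod (Cu j) w) else 0)
   - iter i.+1 negX (iprod (Cu i) w).
  rewrite iprod_lieV lie_corr_total_x// iter_negXD; [|tame_tac|case: i => [|i]; tame_tac].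
  rewrite addrC; congr (_ + _); first by case: i => [|i] //; rewrite iter_negX0.
  by rewrite iterSr /negX -iter_negXN ?opprK//; tame_tac.
under eq_bigr => i _ do rewrite E.
rewrite sumrB (sum_form_recl
  (fun i => if i is j.+1 then iter j.+1 negX (iprod (Cu j) w) else 0)) add0r.
rewrite (sum_form_recr (fun i => iter i.+1 negX (iprod (Cu i) w))).
rewrite (_ : iprod (Cu (N + P)) w = 0) ?iter_negX0 ?addr0; last first.
  case: wN => _ _ zw; apply/funext => s; apply: (zw (N + P)%N); first exact: leq_addr.
  by rewrite inE eqxx.
by rewrite subrr.
Qed.

End Euler.

(** * Symbols of 2-forms *)

Section Symbol.
Context {R : realType}.
Implicit Types (f K : fn R) (V W : vfield R) (a b w v : dform R) (p : jet R).

Definition deg_lt d w := forall i j, (d <= i + j)%N -> w [:: Cu i; Cu j] = 0.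

(** The part of degree [d] of the symbol at [p] is a homogeneous polynomial in two
    variables. It is dehomogenized: the second variable is set to 1. *)
Definition symbol d w p : {poly R} := \poly_(i < d.+1) w [:: Cu i; Cu (d - i)] p.

Lemma symbol_eq0 d e w p : deg_lt d w -> (d <= e)%N -> symbol e w p = 0.
Proof.
move=> dw de; apply/polyP => i; rewrite coef_poly coef0; case: ltnP => // ie.
by rewrite dw// addnC subnK.
Qed.

Lemma deg_ltN d a : deg_lt d a -> deg_lt d (- a).
Proof. by move=> da i j ij; rewrite formNE da// oppr0. Qed.

Lemma deg_ltZ d f a : deg_lt d a -> deg_lt d (f ** a).
Proof. by move=> da i j ij; rewrite /fscale da// mulr0. Qed.

Lemma symbolD d a b p : symbol d (a + b) p = symbol d a p + symbol d b p.
Proof.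
apply/polyP => i; rewrite coefD !coef_poly; case: ltnP => // _.
by rewrite addr0.
Qed.

Lemma symbolN d a p : symbol d (- a) p = - symbol d a p.
Proof.
apply/polyP => i; rewrite coefN !coef_poly; case: ltnP => // _.
by rewrite oppr0.
Qed.

Lemma symbol0 d p : symbol d 0 p = 0.
Proof. by apply: (@symbol_eq0 0). Qed.

Lemma symbolZ d f a p : symbol d (f ** a) p = f p *: symbol d a p.
Proof.
apply/polyP => i; rewrite coefZ !coef_poly; case: ltnP => // _.
by rewrite mulr0.
Qed.

Lemma symbol_sum d (I : Type) (r : seq I) (F : I -> dform R) p :
  symbol d (\sum_(i <- r) F i) p = \sum_(i <- r) symbol d (F i) p.
Proof.
elim: r => [|i r IH]; first by rewrite !big_nil symbol0.
by rewrite !big_cons symbolD IH.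
Qed.

Lemma coef_symbol d w p i : deg_lt d.+1 w ->
  (symbol d w p)`_i = if (i <= d)%N then w [:: Cu i; Cu (d - i)] p else 0.
Proof. by move=> dw; rewrite coef_poly ltnS. Qed.

Lemma total_x_comp w i j : tame w ->
  lieV total_x w [:: Cu i; Cu j] = Dx (w [:: Cu i; Cu j])
  + (if i is i'.+1 then w [:: Cu i'; Cu j] else 0)
  + (if j is j'.+1 then w [:: Cu i; Cu j'] else 0).
Proof.
move=> tw; have ti := tame_iprod (Cu i) tw.
transitivity (iprod (Cu j) (iprod (Cu i) (lieV total_x w)) [::]) => //.
rewrite iprod_lieV (lie_corr_total_x _ tw) iprodD iprod_lieV (lie_corr_total_x _ ti).
rewrite !formDE -addrA [X in _ + X]addrC addrA; congr (_ + _ + _).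
- by case: i {ti}.
- by case: j.
Qed.

Lemma deg_lt_total_x d w : tame w -> deg_lt d w -> deg_lt d.+1 (lieV total_x w).
Proof.
move=> tw dw i j ij; rewrite total_x_comp// dw ?(leq_trans _ ij)//.
have -> : (if i is i'.+1 then w [:: Cu i'; Cu j] else 0) = 0.
  by case: i ij => // i; rewrite addSn ltnS => /dw.
have -> : (if j is j'.+1 then w [:: Cu i; Cu j'] else 0) = 0.
  by case: j ij => // j; rewrite addnS ltnS => /dw.
by rewrite /Dx vact0 !addr0.
Qed.

(** [X] multiplies the symbol by the sum of the two variables. *)
Lemma symbol_total_x d w p : tame w -> deg_lt d.+1 w ->
  symbol d.+1 (lieV total_x w) p = (1 + 'X) * symbol d w p.
Proof.
move=> tw dw; apply/polyP => i.
rewrite mulrDl mul1r coefD coefXM (coef_symbol _ _ (deg_lt_total_x tw dw)).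
rewrite !(coef_symbol _ _ dw).
have [id|di] := leqP i d.+1; last first.
  rewrite leqNgt (ltnW di) add0r; case: i di => // i; rewrite ltnS => di /=.
  by rewrite leqNgt di.
rewrite total_x_comp// (dw i (d.+1 - i)%N) ?subnKC// /Dx vact0 add0r.
rewrite [LHS](_ : _ = (if i is i'.+1 then w [:: Cu i'; Cu (d.+1 - i)] else 0) p
  + (if (d.+1 - i)%N is j'.+1 then w [:: Cu i; Cu j'] else 0) p)//.
rewrite addrC; congr (_ + _).
  have [id'|di'] := leqP i d; first by rewrite subSn.
  by rewrite (_ : (d.+1 - i)%N = 0%N)//; apply/eqP; rewrite subn_eq0.
case: i id => // i; rewrite ltnS => id /=.
by rewrite id subSS.
Qed.

Lemma deg_lt_iter_negX d k w : tame w -> deg_lt d w -> deg_lt (k + d) (iter k negX w).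
Proof.
move=> tw dw; elim: k => [//|k IH] /=; rewrite addSn; apply: deg_ltN.
by apply: deg_lt_total_x => //; exact: tame_iter_negX.
Qed.

Lemma symbol_iter_negX d k w p : tame w -> deg_lt d.+1 w ->
  symbol (k + d) (iter k negX w) p = (- (1 + 'X)) ^+ k * symbol d w p.
Proof.
move=> tw dw; elim: k => [|k IH]; first by rewrite expr0 mul1r.
rewrite addSn iterS /negX symbolN symbol_total_x ?IH; last 2 first.
- exact: tame_iter_negX.
- by have := deg_lt_iter_negX (k := k) tw dw; rewrite addnS.
by rewrite exprS mulNr mulrA mulNr.
Qed.

Section Evolution.
Variables (n : nat) (K : fn R).
Hypotheses (sK : smooth K) (Kn : jet_order_le n K).

Lemma partial_iterDx_eq0 h i : (h + n < i)%N -> partial (Cu i) (iter h Dx K) = 0.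
Proof.
elim: h i => [|h IH] i hi; first exact: partial_gt_order Kn hi.
rewrite iterS (partial_Dx _ (smooth_iterDx h sK)) IH; last first.
  by apply: leq_trans hi; rewrite addSn.
by rewrite /Dx vact0 add0r; case: i hi.
Qed.

(** The linearization of [D_x^h K] has the leading term [(dK/du_n) X^(h+n)]. *)
Lemma partial_iterDx_top h : partial (Cu (h + n)) (iter h Dx K) = partial (Cu n) K.
Proof.
elim: h => [//|h IH]; rewrite iterS (partial_Dx _ (smooth_iterDx h sK)).
rewrite partial_iterDx_eq0; last exact: ltnSn.
by rewrite /Dx vact0 add0r -IH.
Qed.

Lemma evol_comp w N i j : tame_le N w ->
  lieV (evol K) w [:: Cu i; Cu j] = vact (evol K) (w [:: Cu i; Cu j])
  + \sum_(h < N) partial (Cu i) (iter h Dx K) * w [:: Cu h; Cu j]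
  + \sum_(h < N) partial (Cu j) (iter h Dx K) * w [:: Cu i; Cu h].
Proof.
move=> wN; have wiN := tame_le_iprod (Cu i) wN.
transitivity (iprod (Cu j) (iprod (Cu i) (lieV (evol K) w)) [::]) => //.
rewrite iprod_lieV (tame_lie_corrE _ _ wN (leqnn N)).
rewrite iprodD iprod_lieV (tame_lie_corrE _ _ wiN (leqnn N)).
rewrite iprod_sum !formDE !form_sumE -addrA [X in _ + X]addrC addrA.
by congr (_ + _ + _); apply: eq_bigr => h _; rewrite -(evolCu K h).
Qed.

(** In degree [d + n] a term is nonzero only if [i <= h + n] and [h + j <= d], that
    is for [h = i - n]. *)
Lemma evol_sum_low d w N i j : tame_le N w -> deg_lt d.+1 w -> (d + n <= i + j)%N ->
  \sum_(h < N) partial (Cu i) (iter h Dx K) * w [:: Cu h; Cu j] =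
  if (n <= i)%N then partial (Cu n) K * w [:: Cu (i - n); Cu j] else 0.
Proof.
move=> [_ _ zw] dw ij.
have z (h : nat) : ((n <= i) && (h == i - n))%N = false ->
    partial (Cu i) (iter h Dx K) * w [:: Cu h; Cu j] = 0.
  move=> hi; have [hj|hj] := leqP d.+1 (h + j); first by rewrite dw ?mulr0.
  rewrite partial_iterDx_eq0 ?mul0r//.
  rewrite ltn_neqAle; apply/andP; split.
    by apply/eqP => e; move: hi; rewrite -e leq_addl addnK eqxx.
  rewrite -(leq_add2r j) (leq_trans _ ij)//.
  by rewrite addnAC leq_add2r -ltnS.
case: leqP => ni; last first.
  by apply: big1 => h _; apply: z; rewrite leqNgt ni.
have [hN|Nh] := ltnP (i - n) N; last first.
  rewrite (zw (i - n)%N) ?mulr0//; last by rewrite inE eqxx.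
  rewrite big1// => h _; apply: z; rewrite ni /=; apply/eqP => e.
  by move: Nh; rewrite -e leqNgt ltn_ord.
rewrite (bigD1 (Ordinal hN))//= big1 ?addr0 => [|h hi].
  by rewrite -{1}(subnK ni) partial_iterDx_top.
by apply: z; rewrite ni /=; apply: contraNF hi => /eqP e; apply/eqP/val_inj.
Qed.

(** The same as [evol_sum_low], for the other argument of the form. *)
Lemma evol_sum_high d w N i j : tame_le N w -> deg_lt d.+1 w -> (d + n <= i + j)%N ->
  \sum_(h < N) partial (Cu j) (iter h Dx K) * w [:: Cu i; Cu h] =
  if (n <= j)%N then partial (Cu n) K * w [:: Cu i; Cu (j - n)] else 0.
Proof.
move=> [_ _ zw] dw ij.
have z (h : nat) : ((n <= j) && (h == j - n))%N = false ->
    partial (Cu j) (iter h Dx K) * w [:: Cu i; Cu h] = 0.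
  move=> hi; have [hj|hj] := leqP d.+1 (i + h); first by rewrite dw ?mulr0.
  rewrite partial_iterDx_eq0 ?mul0r//.
  rewrite ltn_neqAle; apply/andP; split.
    by apply/eqP => e; move: hi; rewrite -e leq_addl addnK eqxx.
  rewrite -(leq_add2l i) (leq_trans _ ij)//.
  by rewrite addnA leq_add2r -ltnS.
case: leqP => ni; last first.
  by apply: big1 => h _; apply: z; rewrite leqNgt ni.
have [hN|Nh] := ltnP (j - n) N; last first.
  rewrite (zw (j - n)%N) ?mulr0//; last by rewrite !inE eqxx orbT.
  rewrite big1// => h _; apply: z; rewrite ni /=; apply/eqP => e.
  by move: Nh; rewrite -e leqNgt ltn_ord.
rewrite (bigD1 (Ordinal hN))//= big1 ?addr0 => [|h hi].
  by rewrite -{1}(subnK ni) partial_iterDx_top.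
by apply: z; rewrite ni /=; apply: contraNF hi => /eqP e; apply/eqP/val_inj.
Qed.

(** [T] acts on [theta^i] with the leading term [(dK/du_n) theta^(i+n)], and so
    multiplies the symbol by [dK/du_n] and the sum of the [n]-th powers of the
    two variables. *)
Lemma symbol_evol d w p : tame w -> deg_lt d.+1 w -> (0 < n)%N ->
  symbol (d + n) (lieV (evol K) w) p =
  partial (Cu n) K p *: ((1 + 'X^n) * symbol d w p).
Proof.
move=> tw dw n0; have [N wN] := tw; apply/polyP => i.
rewrite coefZ mulrDl mul1r coefD coefXnM !(coef_symbol _ _ dw) coef_poly ltnS.
have [idn|] := leqP i (d + n); last first.
  move=> di; rewrite leqNgt (leq_trans _ di) ?ltnS ?leq_addr//.
  rewrite add0r; case: ltnP => ni; first by rewrite mulr0.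
  by rewrite leq_subLR leqNgt addnC di mulr0.
have ij : (d + n <= i + (d + n - i))%N by rewrite subnKC.
rewrite (evol_comp _ _ wN) (evol_sum_low wN dw ij) (evol_sum_high wN dw ij).
rewrite (dw i (d + n - i)%N); last by rewrite subnKC// -addn1 leq_add2l.
rewrite vact0 add0r.
rewrite [LHS](_ : _ =
   (if (n <= i)%N then partial (Cu n) K * w [:: Cu (i - n); Cu (d + n - i)] else 0) p +
   (if (n <= d + n - i)%N
    then partial (Cu n) K * w [:: Cu i; Cu (d + n - i - n)] else 0) p)//.
rewrite addrC mulrDr; congr (_ + _).
  have -> : (n <= d + n - i)%N = (i <= d)%N.
    by rewrite leq_subRL// leq_add2r.
  case: leqP => id; last by rewrite mulr0.
  by rewrite -subnDA [(i + n)%N]addnC subnDA addnK.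
rewrite ltnNge; case: leqP => ni /=; last by rewrite mulr0.
have -> : (i - n <= d)%N by rewrite leq_subLR addnC.
by rewrite subnBA.
Qed.

Lemma symbol_lin_adjoint d w p : tame w -> deg_lt d.+1 w ->
  symbol (d + n) (lin_adjoint K w) p =
  partial (Cu n) K p *: ((- (1 + 'X)) ^+ n * symbol d w p).
Proof.
move=> tw dw; rewrite (lin_adjointE w Kn (ltnSn n)).
rewrite (sum_form_recr (fun i => iter i negX (partial (Cu i) K ** w))) symbolD symbol_sum.
have tKw i : tame (partial (Cu i) K ** w) by tame_tac.
rewrite big1 ?add0r => [|i _]; last first.
  apply: (symbol_eq0 _ (deg_lt_iter_negX (k := i) (tKw i) (deg_ltZ _ dw))).
  by rewrite addnS addnC ltn_add2l.
by rewrite [(d + n)%N]addnC symbol_iter_negX ?symbolZ -?scalerAr//; exact: deg_ltZ.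
Qed.

(** This is [k1^n + k2^n + (- k1 - k2)^n] at [k1 = 'X] and [k2 = 1]. For [n = 1] the
    polynomial is zero. For larger [n] its coefficient of degree 1
    is [n], up to sign. *)
Lemma power_sum_neq0 : (2 <= n)%N -> 1 + 'X^n + (- (1 + 'X)) ^+ n != 0 :> {poly R}.
Proof.
move=> n2; apply/eqP => /(congr1 (fun q : {poly R} => (deriv q).[0])) /=.
rewrite !poly.derivE deriv_exp !poly.derivE !hornerE.
rewrite !(hornerMn, hornerXn, horner_exp, hornerE, oppr0, addr0) expr0n.
case: n n2 => [|[|m]]// _; rewrite /= mul0rn add0r => /eqP.
by rewrite mulrn_eq0 /= mulf_eq0 expf_eq0 oppr_eq0 oner_eq0 andbF.
Qed.

(** The top symbol of [T w + L_K^* w] is the product of that of [w] with a nonzero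
    polynomial. Hence [w] has no top symbol, whatever bound on its degree one
    starts from. *)
Lemma evolution_kernel w : (2 <= n)%N -> (forall p, partial (Cu n) K p != 0) ->
  tame w -> vertical_form 2 w ->
  lieV (evol K) w + lin_adjoint K w = 0 -> w = 0.
Proof.
move=> n2 K0 tw w2 e.
suff w0 : deg_lt 0 w.
  apply/funext => s; case w2s : ((size s == 2) && all is_vertical s)%N; last first.
    by rewrite w2 ?w2s.
  by case: s w2s => [|[||i] [|[||j] []]] // _; exact: w0.
have [N wN] := tw.
suff descent : forall d, deg_lt d w -> deg_lt 0 w.
  (* a nonzero coefficient has both indices below N *)
  apply: (descent (N + N)%N) => i j ij.
   have [_ _ zw] := wN; have [Ni|iN] := leqP N i.
    by apply: (zw i) => //; rewrite inE eqxx.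
  apply: (zw j); last by rewrite !inE eqxx orbT.
  rewrite leqNgt; apply/negP => jN.
  by move: ij; rewrite leqNgt -addSn leq_add// ltnW.
elim=> [//|d IH] dw; apply: IH => i j; rewrite leq_eqVlt => /predU1P[dij|]; last exact: dw.
apply/funext => p; have := congr1 (fun v : dform R => symbol (d + n) v p) e.
rewrite symbolD symbol_evol ?(ltnW n2)// symbol_lin_adjoint// symbol0 -scalerDr -mulrDl.
move=> /eqP; rewrite scaler_eq0 (negbTE (K0 p)) mulf_eq0 (negbTE (power_sum_neq0 n2)) /=.
move=> /eqP/polyP/(_ i); rewrite coef0 (coef_symbol _ _ dw) dij leq_addr addKn => ->.
by [].
Qed.

End Evolution.
End Symbol.

(** * Lie derivatives in the two coframes *)

Section CoframeDerivatives.
Context {R : realType}.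
Implicit Types (f K : fn R) (V W : vfield R) (a b w v : dform R) (p : jet R).

Lemma eq_derivation V (A B : jcoord -> dform R) w s :
  (forall h g, g \in s -> A h [:: g] = B h [:: g]) -> derivation V A w s = derivation V B w s.
Proof.
elim: s w => [//|g s IH] w AB /=; congr (_ + _).
  by apply: IH => h g' gs; apply: AB; rewrite inE gs orbT.
by apply: eq_fsbigr => h _; rewrite AB// inE eqxx.
Qed.

Lemma coframeE c g : coframe c [:: g] = (g == c)%:R :> fn R.
Proof. by rewrite /coframe eqseq_cons eqxx andbT. Qed.

Lemma DxE_lieV w : DxE w = lieV total_x w.
Proof.
apply/funext => s; apply: eq_derivation => h g _.
rewrite vjac_total_x; case: h => [||i]; [by []|by []|].
rewrite /theta coframeE; case: g => [||[|j]] //.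
suff -> : (Cu j.+1 == Cu i.+1) = (i == j) by [].
by apply/eqP/eqP => [[]|->].
Qed.

Lemma d0E (P : nat -> fn R) f g : smooth f -> d0 P f [:: g] =
  match g with
  | Ct => vact (fun c => match c with Ct => 1 | Cx => 0 | Cu i => P i end) f
  | Cx => Dx f
  | Cu j => partial (Cu j) f
  end.
Proof.
move=> sf; have [N fN] := smooth_order sf.
rewrite /d0 (@fsum_jcoord _ _ N.+1); last first.
  by move=> i Ni; rewrite (partial_gt_order fN Ni) fscale0l.
have E c : (partial c f ** dcoord P c) [:: g] = partial c f * dcoord P c [:: g] by [].
rewrite form_sumE sum_coords !E /=.
have EP i : (theta i + P i ** dt + u_ i.+1 ** dx) [:: g] =
   (g == Cu i)%:R + P i * (g == Ct)%:R + u_ i.+1 * (g == Cx)%:R.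
  by rewrite !formDE /fscale /theta /dt /dx !coframeE.
under eq_bigr => i _ do rewrite E /= EP.
rewrite /dt /dx !coframeE.
case: g {E EP} => [||j].
- rewrite (vactE _ fN) sum_coords eqxx /= mulr0 mul0r mulr1 mul1r.
  congr (_ + (_ + _)); apply: eq_bigr => i _.
  by rewrite /= mulr0 addr0 add0r mulr1 mulrC.
- rewrite /Dx (vactE _ fN) sum_coords /= mulr0 mul0r mulr1 mul1r.
  congr (_ + (_ + _)); apply: eq_bigr => i _.
  by rewrite /= mulr0 addr0 add0r mulr1 mulrC.
rewrite /= !mulr0 !add0r.
have [jN|Nj] := ltnP j N.+1; last first.
  rewrite (partial_gt_order fN Nj) big1// => i _.
  rewrite (_ : (Cu j == Cu i) = false) ?mulr0 ?addr0 ?mulr0//.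
  by apply/eqP => -[e]; move: Nj; rewrite e leqNgt ltn_ord.
rewrite (bigD1 (Ordinal jN))//= big1 => [|i ij].
  by rewrite eqxx /= !mulr0 !addr0 mulr1.
rewrite (_ : (Cu j == Cu i) = false) ?mulr0 ?addr0 ?mulr0//.
by apply: contraNF ij => /eqP[e]; apply/eqP/val_inj.
Qed.

Lemma d0_cst (P : nat -> fn R) c : d0 P (cst c) = 0.
Proof. by apply: fsbig1 => d _; rewrite partial_cst fscale0l. Qed.

(** A field that commutes with [D_x] preserves the contact ideal of the jet space,
    hence there is no [dx] term. There is no [dt] term either if [V] also
    commutes with the evolution in the direction of [dt], which is prescribed by
    [P]. *)
Lemma lie_coframe_vjac (P : nat -> fn R) V h g : contact_field V ->
  (exists k : R, V Ct = cst k) -> (exists k : R, V Cx = cst k) ->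
  (forall i, Dx (V (Cu i)) = V (Cu i.+1)) ->
  (g = Ct -> forall i, vact (fun c => match c with Ct => 1 | Cx => 0 | Cu i => P i end)
     (V (Cu i)) = vact V (P i)) ->
  lie_coframe P V h [:: g] = vjac V h g.
Proof.
move=> [sV _] [k kE] [l lE] VD VP; rewrite /vjac; case: h => [||i] /=.
- by rewrite kE d0_cst.
- by rewrite lE d0_cst.
rewrite kE lE !d0_cst !fscale0r !addr0 !(formDE, formNE) (d0E _ _ (sV _)).
rewrite /fscale /dt /dx !coframeE vact_u.
case: g VP => [||j] VP.
- by rewrite VP//= mulr1 mulr0 subrr subr0.
- by rewrite /= VD mulr1 mulr0 subr0 subrr.
by rewrite /= !mulr0 !subr0.
Qed.

Lemma evol_match K : (fun c => match c with Ct => 1 | Cx => 0 | Cu i => iter i Dx K end)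
  = evol K.
Proof.
by apply/funext => -[||i]; rewrite ?evolCt ?evolCx ?evolCu.
Qed.

Lemma lieR_total_x K w : smooth K -> lieR K total_x w = lieV total_x w.
Proof.
move=> sK; apply/funext => s; apply: eq_derivation => h g _.
apply: lie_coframe_vjac.
- exact: contact_total_x.
- by exists 0.
- by exists 1.
- by move=> i; rewrite /Dx vact_u.
by move=> _ i; rewrite evol_match vact_u evolCu.
Qed.

Lemma lieR_evol K w : smooth K -> lieR K (evol K) w = lieV (evol K) w.
Proof.
move=> sK; apply/funext => s; apply: eq_derivation => h g _.
apply: lie_coframe_vjac.
- exact: contact_evol.
- by exists 1; rewrite evolCt.
- by exists 0; rewrite evolCx.
- by move=> i; rewrite !evolCu.
by move=> _ i; rewrite evol_match evolCu.
Qed.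

(** On [E] the Lie derivative of [theta^i] has a [dt] term; it is invisible on
    lists of vectors that do not contain [d/dt]. *)
Lemma lieE_evol K w s : smooth K -> Ct \notin s ->
  lieE (evol K) w s = lieV (evol K) w s.
Proof.
move=> sK Cts; apply: eq_derivation => h g gs.
apply: lie_coframe_vjac.
- exact: contact_evol.
- by exists 1; rewrite evolCt.
- by exists 0; rewrite evolCx.
- by move=> i; rewrite !evolCu.
by move=> gE; move: Cts; rewrite -gE gs.
Qed.

End CoframeDerivatives.

(** * 1-forms as differential operators *)

Section Pairing.
Context {R : realType}.
Implicit Types (f K : fn R) (a b w v : dform R) (p : jet R).

(** The 1-form [sum_l v_l theta^l] stands for the operator
    [sum_l v_l D_x^l]. *)
Definition pairing v f : fn R :=
  \sum_(l \in [set: nat]) v [:: Cu l] * iter l Dx f.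

Lemma pairingE N M v f : tame_le N v -> (N <= M)%N ->
  pairing v f = \sum_(l < M) v [:: Cu l] * iter l Dx f.
Proof.
move=> [_ _ zv] NM; apply: fsum_nat => l Ml.
rewrite (zv l) ?mul0r//; first exact: leq_trans Ml.
by rewrite inE eqxx.
Qed.

Lemma pairingD a b f : tame a -> tame b -> pairing (a + b) f = pairing a f + pairing b f.
Proof.
move=> ta tb; have [N [aN bN]] := common_tame ta tb.
rewrite (pairingE f aN (leqnn N)) (pairingE f bN (leqnn N)).
rewrite (pairingE f (tame_leD aN bN) (leqnn N)) -big_split.
by apply: eq_bigr => l _; rewrite formDE mulrDl.
Qed.

Lemma pairing0 f : pairing 0 f = 0.
Proof. by apply: fsbig1 => l _; rewrite mul0r. Qed.

Lemma pairingN a f : tame a -> pairing (- a) f = - pairing a f.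
Proof.
move=> ta; apply: (addrI (pairing a f)).
by rewrite -pairingD ?subrr ?pairing0//; tame_tac.
Qed.

Lemma pairing_sum (I : Type) (r : seq I) (F : I -> dform R) f : (forall i, tame (F i)) ->
  pairing (\sum_(i <- r) F i) f = \sum_(i <- r) pairing (F i) f.
Proof.
move=> tF; elim: r => [|i r IH]; first by rewrite !big_nil pairing0.
by rewrite !big_cons pairingD ?IH; [|tame_tac|tame_tac].
Qed.

Lemma sum_fn_recr (F : nat -> fn R) n : \sum_(i < n.+1) F i = \sum_(i < n) F i + F n.
Proof. exact: big_ord_recr. Qed.

Lemma sum_fn_recl (F : nat -> fn R) n : \sum_(i < n.+1) F i = F 0%N + \sum_(i < n) F i.+1.
Proof. exact: big_ord_recl. Qed.

(** [X] corresponds to the composition with [D_x] on the left. *)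
Lemma pairing_total_x v f : tame v -> smooth f ->
  pairing (lieV total_x v) f = Dx (pairing v f).
Proof.
move=> tv sf; have [N vN] := tv; have [M XM] := tame_lieV (@smooth_total_x R) tv.
have NL : (N <= N + M)%N by rewrite leq_addr.
have ML : (M <= (N + M).+1)%N by rewrite leqW// leq_addl.
have E l : lieV total_x v [:: Cu l] =
   Dx (v [:: Cu l]) + (if l is l'.+1 then v [:: Cu l'] else 0).
  transitivity (iprod (Cu l) (lieV total_x v) [::]) => //.
  by rewrite iprod_lieV (lie_corr_total_x _ tv) formDE lieV_nil; case: l.
rewrite (pairingE f XM ML) (pairingE f vN NL).
under eq_bigr => l _ do rewrite E mulrDl.
rewrite big_split.
rewrite (_ : \sum_(i < (N + M).+1) Dx (v [:: Cu i]) * iter i Dx f =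
  \sum_(i < N + M) Dx (v [:: Cu i]) * iter i Dx f); last first.
  rewrite (sum_fn_recr (fun i => Dx (v [:: Cu i]) * iter i Dx f)).
  have [_ _ zv] := vN.
  by rewrite (zv (N + M)%N) ?inE ?eqxx// /Dx vact0 mul0r addr0.
rewrite (sum_fn_recl (fun i => (if i is l.+1 then v [:: Cu l] else 0) * iter i Dx f)).
rewrite mul0r [RHS]/Dx vact_sum; last first.
  by move=> l; apply: smoothM; [exact: tame_smooth|exact: smooth_iterDx].
rewrite [LHS](_ : _ = \sum_(i < N + M) Dx (v [:: Cu i]) * iter i Dx f
  + \sum_(i < N + M) v [:: Cu i] * iter i.+1 Dx f); last by congr (_ + _); exact: add0r.
rewrite -big_split; apply: eq_bigr => l _.
by rewrite (vactM _ (tame_smooth _ tv) (smooth_iterDx l sf)).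
Qed.

Lemma pairing_iter_negX i v f : tame v -> smooth f ->
  pairing (iter i negX v) f = iter i (fun g => - Dx g) (pairing v f).
Proof.
move=> tv sf; elim: i => //= i <-.
have ti := tame_iter_negX i tv.
by rewrite /negX pairingN ?pairing_total_x//; tame_tac.
Qed.

(** Test functions with a prescribed single nonzero [x]-derivative at the points
    where [x = c]. *)
Definition xpow (c : R) k : fn R := fun p => (p Cx - c) ^+ k.

Lemma smooth_xpow c k : smooth (xpow c k).
Proof.
elim: k => [|k IH]; first exact: smooth1.
rewrite (_ : xpow c k.+1 = ((fun p : jet R => p Cx) - cst c) * xpow c k).
  by apply: (smoothM _ IH); apply: smoothD; [exact: smooth_coord|exact/smoothN/smooth_cst].
by apply/funext => p; rewrite /xpow exprS.
Qed.

Lemma Dx_xpow c k : Dx (xpow c k.+1) = xpow c k *+ k.+1.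
Proof.
have sx : smooth (xpow c 1) by exact: smooth_xpow.
have D1 : Dx (xpow c 1) = 1.
  rewrite (_ : xpow c 1 = (fun p : jet R => p Cx) - cst c); last first.
    by apply/funext => p; rewrite /xpow expr1.
  rewrite /Dx vactD; [|exact: smooth_coord|exact/smoothN/smooth_cst].
  rewrite vactN; last exact: smooth_cst.
  by rewrite vact_cst subr0 vact_coord.
elim: k => [|k IH]; first by rewrite D1 mulr1n.
have -> : xpow c k.+2 = xpow c 1 * xpow c k.+1.
  by apply/funext => p; rewrite /xpow exprS.
rewrite /Dx (vactM _ sx (smooth_xpow c k.+1)) -/(Dx _) -/(Dx _) D1 IH mul1r [RHS]mulrS; congr (_ + _).
rewrite mulrnAr; congr (_ *+ _).
by apply/funext => p; rewrite /xpow [RHS]exprS.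
Qed.

Lemma Dx_natmul f m : smooth f -> Dx (f *+ m) = Dx f *+ m.
Proof.
move=> sf; have sfm m' : smooth (f *+ m').
  by elim: m' => [|m' IH]; [rewrite mulr0n; exact: smooth0|rewrite mulrS; exact: smoothD].
elim: m => [|m IH]; first by rewrite !mulr0n /Dx vact0.
by rewrite !mulrS -IH /Dx (vactD _ sf (sfm m)).
Qed.

Lemma iter_Dx_xpow l k p : iter l Dx (xpow (p Cx) k) p = (l == k)%:R * (k`!)%:R.
Proof.
have sn k' m : smooth (xpow (p Cx) k' *+ m).
  elim: m => [|m' IH]; first by rewrite mulr0n; exact: smooth0.
  by rewrite mulrS; apply: (smoothD _ IH); exact: smooth_xpow.
have IN j k' m : iter j Dx (xpow (p Cx) k' *+ m) = iter j Dx (xpow (p Cx) k') *+ m.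
  elim: j => //= j ->; apply: Dx_natmul; apply: smooth_iterDx; exact: smooth_xpow.
elim: l k => [|l IH] [|k].
- by rewrite /= /xpow expr0 mulr1.
- by rewrite /= /xpow subrr expr0n /= mul0r.
- rewrite iterSr (_ : xpow (p Cx) 0 = 1) //.
  rewrite /Dx vact1 mul0r (_ : iter l _ 0 = 0)//.
  by elim: l {IH} => //= l ->; rewrite vact0.
rewrite iterSr Dx_xpow IN.
rewrite [LHS](_ : _ = iter l Dx (xpow (p Cx) k) p *+ k.+1); last first.
  elim: (k.+1) => [|m IHm]; first by rewrite !mulr0n.
  by rewrite [in RHS]mulrS -IHm [in LHS]mulrS.
by rewrite IH eqSS factS natrM -[LHS]mulr_natr -mulrA; congr (_ * _); exact: mulrC.
Qed.

(** At a point where [x = c], the [l]-th derivative of [xpow c k] is nonzero only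
    for [l = k]. *)
Lemma pairing_inj v : tame v -> (forall f, smooth f -> pairing v f = 0) ->
  forall k, v [:: Cu k] = 0.
Proof.
move=> [N vN] v0 k; apply/funext => p.
have := congr1 (fun g : fn R => g p) (v0 _ (smooth_xpow (p Cx) k)).
rewrite (pairingE _ vN (leq_addr k.+1 N)).
rewrite (_ : (\sum_(l < _) _) p =
  \sum_(l < N + k.+1) v [:: Cu l] p * iter l Dx (xpow (p Cx) k) p); last first.
  by apply: (big_morph (fun g : fn R => g p)).
have kL : (k < N + k.+1)%N by rewrite addnS ltnS leq_addl.
rewrite (bigD1 (Ordinal kL))//= iter_Dx_xpow eqxx big1 ?addr0 => [|l lk].
  rewrite mul1r => /eqP; rewrite mulf_eq0 pnatr_eq0 (gtn_eqF (fact_gt0 k)) orbF.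
  by move=> /eqP.
rewrite iter_Dx_xpow (_ : (l == k :> nat) = false) ?mul0r ?mulr0//.
by apply: contraNF lk => /eqP e; apply/eqP/val_inj.
Qed.

End Pairing.

(** * The 2-form of a skew-adjoint operator *)

Section Operator.
Context {R : realType}.
Implicit Types (f K : fn R) (a b w v : dform R) (s : nat -> fn R).

Lemma lieV_base_wedge V c w : smooth_field V -> ~~ is_vertical c -> tame w ->
  lieV V (coframe c \wedge w) = coframe c \wedge lieV V w.
Proof.
move=> sV cv tw; rewrite (@lieV_coframe_wedge _ V c w 0)// ?big_ord0 ?add0r//.
by case: c cv.
Qed.

Lemma lieV_theta_wedge i w : tame w ->
  lieV total_x (theta i \wedge w) = theta i.+1 \wedge w + theta i \wedge lieV total_x w.
Proof.
move=> tw; rewrite (lieV_coframe_wedge (c := Cu i) (N := i.+2) smooth_total_x)//.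
  congr (_ + _); rewrite (bigD1 ord_max)//= vjac_total_x eqxx fscale1 big1 ?addr0// => j ji.
  rewrite vjac_total_x; case jE : (nat_of_ord j) => [|k]; first by rewrite fscale0l.
  rewrite (_ : (i == k) = false) ?fscale0l//.
  by apply: contraNF ji => /eqP ik; apply/eqP/val_inj; rewrite /= jE ik.
move=> [//|j]; rewrite ltnS => ij; rewrite vjac_total_x.
by rewrite (_ : (i == j) = false)//; apply: ltn_eqF.
Qed.

Lemma evol_theta0_wedge K n w : smooth K -> jet_order_le n K -> tame w ->
  lieV (evol K) (theta 0 \wedge w) =
  \sum_(j < n.+1) partial (Cu j) K ** (theta j \wedge w) + theta 0 \wedge lieV (evol K) w.
Proof.
move=> sK Kn tw; rewrite (lieV_coframe_wedge (c := Cu 0) (N := n.+1) (smooth_evol sK))//.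
  by congr (_ + _); apply: eq_bigr => j _; rewrite /vjac evolCu.
by move=> j nj; rewrite /vjac evolCu; exact: partial_gt_order Kn nj.
Qed.

Lemma iprod_base_wedge c k w : vertical_form k w -> ~~ is_vertical c ->
  iprod c (coframe c \wedge w) = w.
Proof.
move=> kw cv; rewrite iprod_coframe_wedge eqxx (vertical_iprod_eq0 kw) ?cv//.
by rewrite wedge0r subr0.
Qed.

Lemma dt_dx_wedge_eq0 k w : vertical_form k w -> dt \wedge dx \wedge w = 0 -> w = 0.
Proof.
move=> kw /(congr1 (fun v => iprod Cx (iprod Ct v))).
rewrite [iprod Ct _]iprod_coframe_wedge eqxx [iprod Ct _]iprod_coframe_wedge /=.
rewrite (vertical_iprod_eq0 (g := Ct) kw)// wedge0r subr0 wedge0r subr0.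
by rewrite (iprod_base_wedge (c := Cx) kw) ?iprod0.
Qed.

Lemma dx_wedge_eq0 k w : vertical_form k w -> dx \wedge w = 0 -> w = 0.
Proof.
move=> kw /(congr1 (iprod Cx)).
by rewrite (iprod_base_wedge (c := Cx) kw) ?iprod0.
Qed.

Section Coefficients.
Variable s : nat -> fn R.
Hypothesis s_op : diff_operator s.

Lemma epsE N : (forall i, (N < i)%N -> s i = 0) -> eps s = \sum_(i < N.+1) s i ** theta i.
Proof. by move=> sN; apply: fsum_nat => i Ni; rewrite sN ?fscale0l. Qed.

Lemma smooth_op i : smooth (s i). Proof. by case: s_op. Qed.

Lemma tame_eps : tame (eps s).
Proof.
have [_ [N sN]] := s_op; rewrite (epsE sN); apply: tame_sum => i _.
exact/tame_theta/smooth_op.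
Qed.

Lemma vertical_theta i : vertical_form 1 (theta i : dform R).
Proof.
by move=> r; rewrite /theta /coframe; case: (r =P [:: Cu i]) => [->|_].
Qed.

Lemma vertical_eps : vertical_form 1 (eps s).
Proof.
have [_ [N sN]] := s_op; rewrite (epsE sN); apply: vertical_form_sum => i.
exact/vertical_formZ/vertical_theta.
Qed.

Lemma eps_comp i : eps s [:: Cu i] = s i.
Proof.
have [_ [N sN]] := s_op; rewrite (epsE sN) form_sumE.
have E j : (s j ** theta j) [:: Cu i] = if i == j then s j else 0.
  rewrite /fscale /theta coframeE.
  have -> : (Cu i == Cu j) = (i == j) by apply/eqP/eqP => [[]|->].
  by case: eqP; rewrite ?mulr1 ?mulr0.
under eq_bigr => j _ do rewrite E.
have [iN|Ni] := leqP i N.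
  rewrite (bigD1 (Ordinal (iN : (i < N.+1)%N)))//= eqxx big1 ?addr0// => j ji.
  by rewrite (_ : (i == j) = false)//; apply: contraNF ji => /eqP e; apply/eqP/val_inj.
rewrite (sN i Ni) big1// => j _; rewrite (_ : (i == j) = false)//.
by apply/eqP => e; move: Ni; rewrite e ltnNge -ltnS ltn_ord.
Qed.

Definition adjoint_eps : dform R := \sum_(i \in [set: nat]) iter i negX (s i ** theta 0).

Lemma adjoint_epsE N : (forall i, (N < i)%N -> s i = 0) ->
  adjoint_eps = \sum_(i < N.+1) iter i negX (s i ** theta 0).
Proof.
by move=> sN; apply: fsum_nat => i Ni; rewrite sN// fscale0l iter_negX0.
Qed.

Lemma tame_adjoint_eps : tame adjoint_eps.
Proof.
have [_ [N sN]] := s_op; rewrite (adjoint_epsE sN); apply: tame_sum => i _.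
exact/tame_iter_negX/tame_theta/smooth_op.
Qed.

Lemma pairing_theta f g i : pairing (f ** theta i) g = f * iter i Dx g.
Proof.
rewrite /pairing -(fsbig_widen [set i])//; last first.
  move=> j [_ /eqP ji] /=; rewrite /fscale /theta coframeE.
  rewrite (_ : (Cu j == Cu i) = false) ?mulr0 ?mul0r//.
  by apply: contra_neqF ji => /eqP[].
by rewrite fsbig_set1 /fscale /theta coframeE eqxx mulr1.
Qed.

(** An operator is determined by its values, so that skew-adjointness, which is
    stated on functions, is an identity between 1-forms. *)
Lemma adjoint_eps_skew : skew_adjoint s -> adjoint_eps = - eps s.
Proof.
move=> skew; have [_ [N sN]] := s_op.
have te := tame_eps; have ta := tame_adjoint_eps.
have tt i : tame (s i ** theta 0) by exact/tame_theta/smooth_op.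
have tti i : tame (s i ** theta i) by exact/tame_theta/smooth_op.
have P f : smooth f -> pairing (adjoint_eps + eps s) f = 0.
  move=> sf; have := skew f sf.
  rewrite (@fsum_nat _ _ N.+1) => [|i Ni]; last first.
    rewrite sN// mul0r; elim: i {Ni} => //= i ->.
    by rewrite /Dx vact0 oppr0.
  rewrite (@fsum_nat _ _ N.+1) => [|i Ni]; last by rewrite sN// mul0r.
  rewrite pairingD// (adjoint_epsE sN) (epsE sN) !pairing_sum//; last first.
    by move=> i; exact: tame_iter_negX.
  under [X in _ -> X + _ = _]eq_bigr => i _ do
    rewrite pairing_iter_negX// pairing_theta.
  under [X in _ -> _ + X = _]eq_bigr => i _ do rewrite pairing_theta.
  by move=> ->; rewrite addNr.
apply/eqP; rewrite -addr_eq0; apply/eqP.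
have z := pairing_inj (tameD ta te) P.
have va : vertical_form 1 (adjoint_eps + eps s).
  apply: vertical_formD; last exact: vertical_eps.
  rewrite (adjoint_epsE sN); apply: vertical_form_sum => i.
  exact/vertical_iter_negX/vertical_formZ/vertical_theta.
apply/funext => r; case r1 : ((size r == 1%N) && all is_vertical r); last first.
  by rewrite va ?r1.
by case: r r1 => [|[||i] []] // _; exact: z.
Qed.

(** The 2-form [theta^0 /\ eps] represents the bilinear map [f, g |-> f S g - g S f]
    modulo total derivatives, where [S] is the operator of [eps]; the Euler
    operator extracts [S] minus its adjoint. *)
Lemma euler_theta0_eps : skew_adjoint s -> euler (theta 0 \wedge eps s) = eps s + eps s.
Proof.
move=> skew; have [_ [N sN]] := s_op; have te := tame_eps.
have [M tM] := tame_coframe_wedge (Cu 0) te.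
have NL : (M <= (M + N).+1)%N by rewrite leqW// leq_addr.
rewrite (eulerE tM NL).
have E i : iprod (Cu i) (theta 0 \wedge eps s) =
   (if i is 0%N then eps s else 0) - s i ** theta 0.
  rewrite iprod_coframe_wedge; congr (_ - _).
    by case: i.
  have -> : iprod (Cu i) (eps s) = (fun r => if r is [::] then s i else 0).
    apply/funext => -[|c r]; first exact: eps_comp.
    by apply: vertical_eps.
  rewrite -[in RHS]wedge_fun wedge_coframe_r; congr (_ \wedge _).
  by apply/funext => -[|c r]; rewrite /grade_sign ?mulr0// expr0 mul1r.
under eq_bigr => i _.
  rewrite E iter_negXD; last 2 first.
  - by case: (nat_of_ord i) => [|?]; tame_tac.
  - by apply/tameN/tame_theta/smooth_op.
  rewrite iter_negXN; last exact/tame_theta/smooth_op.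
  over.
rewrite sumrB; congr (_ + _).
  rewrite (sum_form_recl (fun i => iter i negX (if i is 0%N then eps s else 0))).
  by rewrite big1 ?addr0// => i _; exact: iter_negX0.
rewrite -[RHS]opprK -(adjoint_eps_skew skew); congr (- _).
rewrite (@adjoint_epsE (M + N))// => i Ni; apply: sN.
by apply: leq_ltn_trans Ni; exact: leq_addl.
Qed.

Section Equation.
Variables (n : nat) (K : fn R).
Hypotheses (sK : smooth K) (Kn : jet_order_le n K).

Lemma betaE w : vertical_form 1 w ->
  beta n K w = - \sum_(1 <= i < n.+1) \sum_(1 <= a < i.+1)
    (theta (i - a) \wedge iter a.-1 negX (partial (Cu i) K ** w)).
Proof.
move=> w1; rewrite /beta -sumrN; apply: eq_bigr => i _.
rewrite -sumrN; apply: eq_bigr => a _.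
rewrite (_ : (fun v => - lieR K total_x v) = negX); last first.
  by apply/funext => v; rewrite /negX lieR_total_x.
rewrite wedge_coframe_r grade_sign_vertical1 ?wedgeNr//.
exact/vertical_iter_negX/vertical_formZ.
Qed.

Lemma tame_beta w : tame w -> vertical_form 1 w -> tame (beta n K w).
Proof.
move=> tw w1; rewrite betaE//; apply: tameN; apply: tame_sum => i _.
apply: tame_sum => a _; apply: tame_coframe_wedge; apply: tame_iter_negX; tame_tac.
Qed.

Lemma skew_beta w : vertical_form 1 w -> skew_form (beta n K w).
Proof.
move=> w1; rewrite betaE//; apply: skew_formN; apply: skew_form_sum => i.
apply: skew_form_sum => a; apply: skew_form_coframe_wedge; apply: skew_form_vertical1.
exact/vertical_iter_negX/vertical_formZ.
Qed.

(** Each summand of [beta] is built so that [X] moves one derivative from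
    [theta^i] to the other factor: the inner sum telescopes. *)
Lemma total_x_beta w : tame w -> vertical_form 1 w ->
  lieV total_x (beta n K w) =
  theta 0 \wedge lin_adjoint K w - \sum_(j < n.+1) partial (Cu j) K ** (theta j \wedge w).
Proof.
move=> tw w1; rewrite betaE//.
have tv i (j : nat) : tame (iter j negX (partial (Cu i) K ** w)).
  by apply: tame_iter_negX; tame_tac.
have tij i (a : nat) : tame (theta (i - a) \wedge iter a.-1 negX (partial (Cu i) K ** w)).
  exact: tame_coframe_wedge.
have ti i : tame (\sum_(1 <= a < i.+1)
    (theta (i - a) \wedge iter a.-1 negX (partial (Cu i) K ** w))).
  by apply: tame_sum.
rewrite lieVN; last by apply: tame_sum.
rewrite lieV_sum// -sumrN.
have step i : - lieV total_x (\sum_(1 <= a < i.+1)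
    (theta (i - a) \wedge iter a.-1 negX (partial (Cu i) K ** w))) =
    (theta 0 \wedge iter i negX (partial (Cu i) K ** w))
    - partial (Cu i) K ** (theta i \wedge w).
  pose F (a : nat) := theta (i - a) \wedge iter a negX (partial (Cu i) K ** w).
  rewrite lieV_sum// -sumrN big_add1 /=.
  transitivity (\sum_(0 <= a < i) (F a.+1 - F a)).
    apply: eq_big_nat => a /andP[_ ai]; rewrite /F lieV_theta_wedge// opprD addrC.
    rewrite -subSn// subSS; congr (_ + _).
    by rewrite iterS /negX wedgeNr.
  by rewrite telescope_sumr// /F subnn subn0 wedgeZr.
rewrite (eq_bigr _ (fun i _ => step i)) sumrB.
rewrite (lin_adjointE w Kn (ltnSn n)) wedge_sumr.
rewrite (sum_form_recl (fun i => theta 0 \wedge iter i negX (partial (Cu i) K ** w))).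
rewrite (sum_form_recl (fun j => partial (Cu j) K ** (theta j \wedge w))).
rewrite wedgeZr opprD addrACA subrr add0r.
by rewrite !big_add1 !big_mkord.
Qed.

(** The 1-form [rho] of the introduction. Its operator is the derivative along
    [T] of the operator of [eps], plus [S L_K + L_K^* S]. *)
Definition evol_defect : dform R := lieV (evol K) (eps s) + lin_adjoint K (eps s).

(** The conservation law with an obstruction: [T] of the density is minus [X] of
    the flux exactly when [theta^0 /\ rho] vanishes. *)
Lemma evol_theta0_eps : lieV (evol K) (theta 0 \wedge eps s) =
  theta 0 \wedge evol_defect - lieV total_x (beta n K (eps s)).
Proof.
have te := tame_eps; have e1 := vertical_eps.
rewrite (evol_theta0_wedge sK Kn te) total_x_beta// /evol_defect wedgeDr.
by rewrite opprB addrC [X in _ = X]addrACA subrr addr0 addrC.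
Qed.

End Equation.
End Coefficients.
End Operator.

(** * The conserved form, the Hamiltonian condition and closedness *)

Section Assembly.
Context {R : realType}.
Implicit Types (f K : fn R) (a b w v : dform R) (s : nat -> fn R).

Lemma euler_dx_wedge w : tame w -> euler (dx \wedge w) = - (dx \wedge euler w).
Proof.
move=> tw; have [N wN] := tw.
have dwN : tame_le N (dx \wedge w) by exact: tame_le_coframe_wedge.
rewrite (eulerE dwN (leqnn N)) (eulerE wN (leqnn N)) wedge_sumr -sumrN.
apply: eq_bigr => i _; rewrite iprod_coframe_wedge sub0r.
have ti : tame (iprod (Cu i) w) by tame_tac.
rewrite iter_negXN; last exact: tame_coframe_wedge.
move: (iprod (Cu i) w) ti => v tv; congr (- _).
elim: (nat_of_ord i) => //= j ->.
rewrite /negX lieV_base_wedge ?wedgeNr//; first exact: smooth_total_x.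
exact: tame_iter_negX.
Qed.

(** Contraction with the [d/du_i], and [theta^0], each change the sign when they
    pass [dx]. *)
Lemma IE_dx_wedge m w : tame w ->
  IE m (dx \wedge w) = cst (m%:R^-1) ** (dx \wedge theta 0 \wedge euler w).
Proof.
move=> tw; rewrite /IE; congr (_ ** _).
have -> : (fun v : dform R => - DxE v) = negX.
  by apply/funext => v; rewrite DxE_lieV.
rewrite -/(euler _) euler_dx_wedge// wedgeNr.
by rewrite [in LHS]/theta /dx coframe_wedgeC opprK.
Qed.

Lemma IE_dx_wedge_eq0 m k w : (0 < m)%N -> tame w -> vertical_form k.+1 w ->
  IE m (dx \wedge w) = 0 <-> theta 0 \wedge euler w = 0.
Proof.
move=> m0 tw kw; rewrite IE_dx_wedge//; split=> [e|->]; last first.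
  by rewrite wedge0r fscale0r.
have ve : vertical_form k.+1 (theta 0 \wedge euler w).
  exact/vertical_coframe_wedge/vertical_euler.
apply: (dx_wedge_eq0 ve).
have mu : cst (m%:R : R) * cst (m%:R^-1 : R) = 1 :> fn R.
  by apply/funext => p; rewrite /= [LHS]mulfV// pnatr_eq0 -lt0n.
by rewrite -[LHS]fscale1 -mu fscaleA e fscale0r.
Qed.

(** The product of [dx] with vertical [k]-forms is of type [(1, k)], so that the
    projection [pi12] does not change it. *)
Lemma dx_wedge_comp k w r : vertical_form k w ->
  ~~ [&& size r == k.+1, count_mem Ct r == 0 & count_mem Cx r == 1]%N ->
  (dx \wedge w) r = 0.
Proof.
elim: r k w => [|g r IH] k w kw gr; first exact: coframe_wedge_nil.
transitivity (iprod g (dx \wedge w) r) => //.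
rewrite iprod_coframe_wedge formDE formNE.
case: g gr => [||i] gr /=.
- by rewrite (vertical_iprod_eq0 kw)// wedge0r subr0.
- rewrite (vertical_iprod_eq0 kw)// wedge0r subr0; apply: kw.
  apply: contra gr => /andP[/eqP rk rv] /=; rewrite rk eqxx add0n /=.
  have z c : ~~ is_vertical c -> count_mem c r = 0%N.
    move=> cv; apply/eqP; rewrite eqn0Ngt -has_count -all_predC.
    apply: sub_all rv => d dv /=; apply/eqP => dc.
    by move: cv; rewrite -dc dv.
  by rewrite !z.
rewrite add0r; case: k kw gr => [|k] kw gr.
  by rewrite (vertical_iprod_eq0 kw) ?orbT// wedge0r oppr0.
rewrite (IH k) ?oppr0//; first exact: vertical_iprod.
Qed.

Section Equivalence.
Variables (n : nat) (K : fn R) (s : nat -> fn R).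
Hypotheses (sK : smooth K) (Kn : jet_order_le n K) (s_op : diff_operator s).

Let te : tame (eps s) := tame_eps s_op.
Let e1 : vertical_form 1 (eps s) := vertical_eps s_op.
Let t2 : tame (theta 0 \wedge eps s) := tame_coframe_wedge (Cu 0) te.
Let v2 : vertical_form 2 (theta 0 \wedge eps s) := vertical_coframe_wedge 0 e1.

(** Of the four terms two contain [dx] or [dt] twice; the two others have the
    common factor [dt /\ dx]. *)
Lemma dH_omega : dH K (omega n K s) =
  dt \wedge dx \wedge theta 0 \wedge evol_defect s K.
Proof.
have sE := smooth_evol sK; have sX := @smooth_total_x R.
have tb := tame_beta n sK te e1.
rewrite /dH /omega lieR_total_x// lieR_evol//.
have t2' := t2; rewrite /dx /dt.
rewrite !lieVD; [|tame_tac|tame_tac|tame_tac|tame_tac].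
rewrite !lieVN; [|tame_tac|tame_tac].
rewrite ![lieV _ (coframe Cx \wedge _)]lieV_base_wedge//.
rewrite ![lieV _ (coframe Ct \wedge _)]lieV_base_wedge//.
rewrite !wedgeDr !wedgeNr !coframe_wedge2 add0r subr0.
rewrite [X in - X]coframe_wedgeC opprK (evol_theta0_eps s_op sK Kn).
by rewrite !wedgeDr !wedgeNr addrCA subrr addr0.
Qed.

Lemma dH_omega_eq0 : dH K (omega n K s) = 0 <-> theta 0 \wedge evol_defect s K = 0.
Proof.
rewrite dH_omega; split=> [|->]; last by rewrite !wedge0r.
apply: (@dt_dx_wedge_eq0 _ 2); apply: vertical_coframe_wedge.
apply: vertical_formD; first exact: vertical_lieV.
rewrite (lin_adjointE _ Kn (ltnSn n)); apply: vertical_form_sum => i.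
exact/vertical_iter_negX/vertical_formZ.
Qed.

Lemma pi12_lieE_SigmaE :
  pi12 (lieE (evol K) (SigmaE s)) = dx \wedge lieV (evol K) (theta 0 \wedge eps s).
Proof.
apply/funext => r; rewrite /pi12; case: ifPn => [/and3P[_ rt _]|rn]; last first.
  by rewrite (dx_wedge_comp (vertical_lieV _ v2) rn).
rewrite lieE_evol//; last first.
  by rewrite -has_pred1 has_count -eqn0Ngt.
by rewrite /SigmaE /dx (lieV_base_wedge (c := Cx) (smooth_evol sK) isT t2).
Qed.

Lemma hamiltonian_iff : skew_adjoint s ->
  hamiltonian K (SigmaE s) <-> theta 0 \wedge evol_defect s K = 0.
Proof.
move=> skew; have sE := smooth_evol sK.
rewrite /hamiltonian pi12_lieE_SigmaE.
rewrite (IE_dx_wedge_eq0 (k := 1))//; [|tame_tac|exact: vertical_lieV].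
rewrite euler_evol// euler_theta0_eps//.
rewrite lieVD// lin_adjointD// addrACA -/(evol_defect s K) wedgeDr.
split=> [e|->]; last by rewrite addr0.
rewrite -[LHS]fscale1.
have h2 : cst (2^-1 : R) * (1 + 1) = 1 :> fn R.
  by apply/funext => p; rewrite -[LHS]/(2^-1 * (1 + 1)) mulVf// pnatr_eq0.
by rewrite -h2 fscaleA fscaleDl fscale1 e fscale0r.
Qed.

(** If [Sigma = 0] then [theta^0 /\ eps = 0], and its image [2 eps] under the Euler
    operator vanishes too. *)
Lemma SigmaE_neq0 : skew_adjoint s -> s <> 0 -> SigmaE s <> 0.
Proof.
move=> skew s0 /(dx_wedge_eq0 v2) e; apply: s0; apply/funext => i.
have := euler_theta0_eps s_op skew; rewrite e (eulerE (tame_le0 0) (leqnn 0)) big_ord0.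
move=> /(congr1 (fun w : dform R => w [:: Cu i])); rewrite formDE (eps_comp s_op).
move=> /esym si; apply/funext => p.
have /eqP := congr1 (fun f : fn R => f p) si.
by rewrite -[X in X == _]mulr2n [_ == _]mulrn_eq0 => /eqP.
Qed.

(** When [theta^0 /\ rho = 0], applying [d_V] and then the Euler operator to the
    conservation law leaves an equation that has only the solution zero. *)
Lemma SigmaE_closed : (2 <= n)%N -> (forall p, partial (Cu n) K p != 0) ->
  theta 0 \wedge evol_defect s K = 0 -> deltaVE 2 (SigmaE s) = 0.
Proof.
move=> n2 K0 e; have sE := smooth_evol sK.
have td := tame_dVE t2; have v3 := vertical_dVE t2 v2.
have tb := tame_beta n sK te e1.
suff r0 : euler (dVE (theta 0 \wedge eps s)) = 0.
  rewrite /deltaVE /SigmaE (dVE_coframe_wedge _ t2) -wedgeNr.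
  apply/(IE_dx_wedge_eq0 (k := 2)); [by []|exact: tameN|exact: vertical_formN|].
  by rewrite eulerN// r0 oppr0 wedge0r.
apply: (evolution_kernel sK Kn n2 K0); [exact: tame_euler|exact: vertical_euler|].
rewrite -euler_evol// -dVE_lieV//; [|exact: contact_evol|]; last first.
  exact/skew_form_coframe_wedge/skew_form_vertical1.
rewrite (evol_theta0_eps s_op sK Kn) e sub0r -lieVN//.
rewrite dVE_lieV; [|exact: contact_total_x|tame_tac|exact/skew_formN/skew_beta].
by apply: euler_total_x; apply: tame_dVE; tame_tac.
Qed.

End Equivalence.
End Assembly.

Theorem theorem7p5 (R : realType) (n : nat) (K : fn R) (s : nat -> fn R)
    (n_ge2 : (2 <= n)%N)
    (K_smooth : smooth K) (K_order : jet_order_le n K)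
    (K_sep : forall p : jet R, partial (Cu n) K p != 0)
    (s_op : diff_operator s) (s_neq0 : s <> 0) (s_skew : skew_adjoint s) :
  (symplectic_form (SigmaE s) /\ hamiltonian K (SigmaE s))
  <-> dH K (omega n K s) = 0.
Proof.
rewrite dH_omega_eq0// hamiltonian_iff//; split=> [[]//|e].
split=> //; split; first exact: SigmaE_neq0.
exact: (SigmaE_closed K_smooth K_order s_op n_ge2 K_sep e).
Qed.
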